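(* Let $\Omega\subset\mathbb R^n$ be a bounded open set and let $\mathbf A_w,\mathbf A_s$ be symmetric fourth-order elasticity tensors (symmetric linear maps on $\mathbb M^{n\times n}_{\rm sym}$) such that, for some constants $c_w,c_s,c_w',c_s'>0$, $$c_i|\xi|^2\le\mathbf A_i\xi:\xi\le c_i'|\xi|^2\quad\text{for all }\xi\in\mathbb M^{n\times n}_{\rm sym},\ i\in\{w,s\}.$$ If $\alpha:=\lim_{\varepsilon\to0}\eta_\varepsilon/\varepsilon=0$, then the functionals $\mathcal E_\varepsilon$ $\Gamma$-converge as $\varepsilon\to0$, with respect to the strong $L^1(\Omega;\mathbb R^n)\times L^1(\Omega)$-topology, to the functional $\Phi_0:L^1(\Omega;\mathbb R^n)\times L^1(\Omega)\to[0,+\infty]$ defined by $$\Phi_0(u,\chi)=\begin{cases}0&\text{if }\chi=0\text{ a.e. in }\Omega,\\+\infty&\text{otherwise.}\end{cases}$$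
   Context: $\mathbb M^{n\times n}_{\rm sym}$ is the space of real symmetric $n\times n$ matrices with Frobenius product $\xi:\eta=\operatorname{tr}(\xi\eta)$ and norm $|\xi|=\sqrt{\xi:\xi}$. For $u\in H^1(\Omega;\mathbb R^n)$, $e(u)=\frac12(\nabla u+\nabla u^T)$. Setting: $\kappa>0$ is a constant and $(\eta_\varepsilon)_{\varepsilon>0}$ is a family of positive numbers with $\eta_\varepsilon\to0$ as $\varepsilon\to0$. For $(u,\chi)\in H^1(\Omega;\mathbb R^n)\times L^\infty(\Omega;\{0,1\})$, $$\mathcal E_\varepsilon(u,\chi):=\frac12\int_\Omega\big[\eta_\varepsilon\chi\mathbf A_w+(1-\chi)\mathbf A_s\big]e(u):e(u)\,dx+\frac\kappa\varepsilon\int_\Omega\chi\,dx,$$ and $\mathcal E_\varepsilon(u,\chi):=+\infty$ for all other $(u,\chi)\in L^1(\Omega;\mathbb R^n)\times L^1(\Omega)$. $\Gamma$-convergence of $\mathcal E_\varepsilon$ to $\Phi_0$ means $\mathcal E_0'=\mathcal E_0''=\Phi_0$, where $\mathcal E_0'(u,\chi)$ (resp. $\mathcal E_0''(u,\chi)$) is the infimum of $\liminf_{\varepsilon\to0}\mathcal E_\varepsilon(u_\varepsilon,\chi_\varepsilon)$ (resp. $\limsup_{\varepsilon\to0}\mathcal E_\varepsilon(u_\varepsilon,\chi_\varepsilon)$) over all $(u_\varepsilon,\chi_\varepsilon)\to(u,\chi)$ in $L^1(\Omega;\mathbb R^n)\times L^1(\Omega)$. *)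

(* Defs.v *)
From HB Require Import structures.
From mathcomp Require Import all_boot all_order all_algebra.
From mathcomp Require Import all_classical all_reals all_analysis.

Set Implicit Arguments.
Unset Strict Implicit.
Unset Printing Implicit Defensive.

Import Order.TTheory GRing.Theory Num.Theory.
Import numFieldNormedType.Exports.

Local Open Scope classical_set_scope.
Local Open Scope ring_scope.

(* R^n is 'rV[R]_n. Its Borel sigma-algebra is presented, as the library does
   for tuples, as the one generated by the coordinate projections. *)
Section rV_measurable.
Context {R : realType} {n : nat}.

Definition rV_coord (i : 'I_n) (v : 'rV[R]_n) : R := v ord0 i.

Let rV_set0 : g_sigma_preimage rV_coord set0.
Proof. exact: sigma_algebra0. Qed.

Let rV_setC A : g_sigma_preimage rV_coord A -> g_sigma_preimage rV_coord (~` A).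
Proof. exact: sigma_algebraC. Qed.

Let rV_bigcup (F : (set 'rV[R]_n)^nat) :
  (forall i, g_sigma_preimage rV_coord (F i)) ->
  g_sigma_preimage rV_coord (\bigcup_i (F i)).
Proof. exact: sigma_algebra_bigcup. Qed.

HB.instance Definition _ := @isMeasurable.Build default_measure_display
  'rV[R]_n (g_sigma_preimage rV_coord) rV_set0 rV_setC rV_bigcup.

End rV_measurable.

Section lebesgue_rV.
Context {R : realType}.

Definition rV_cons n (p : R * 'rV[R]_n) : 'rV[R]_n.+1 :=
  row_mx (p.1)%:M p.2 : 'rV[R]_(1 + n).

Lemma measurable_rV_coord n (i : 'I_n) :
  measurable_fun [set: 'rV[R]_n] (@rV_coord R n i).
Proof.
move=> _ Y mY; rewrite setTI; apply: sub_sigma_algebra => /=.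
rewrite -bigcup_seq/=; exists i => /=; first by rewrite mem_index_enum.
by exists Y => //; rewrite setTI.
Qed.

Lemma measurable_to_rV d (T : measurableType d) n (f : T -> 'rV[R]_n) :
  (forall i, measurable_fun setT (rV_coord i \o f)) -> measurable_fun setT f.
Proof.
move=> mf _ B mB; rewrite setTI; move: B mB.
suff: g_sigma_preimage (@rV_coord R n) `<=` [set B | measurable (f @^-1` B)].
  by apply.
apply: smallest_sub.
  split => /=.
  - by rewrite preimage_set0.
  - by move=> A mA; rewrite setTD preimage_setC; exact: measurableC.
  - by move=> F mF; rewrite preimage_bigcup; exact: bigcupT_measurable.
move=> B; rewrite -bigcup_seq/= => -[i _ [A mA <-]] /=.
by rewrite setTI -comp_preimage -[X in measurable X]setTI; exact: mf.
Qed.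

Lemma measurable_rV_cons n : measurable_fun setT (@rV_cons n).
Proof.
apply: measurable_to_rV => i.
case: (unliftP ord0 i) => [j|] ->.
  rewrite (_ : _ \o _ = rV_coord j \o snd).
    exact: (measurableT_comp (measurable_rV_coord j) measurable_snd).
  apply/funext => p; rewrite /rV_coord /rV_cons/=.
  rewrite (_ : lift ord0 j = rshift 1 j); last exact: ord_inj.
  exact: (@row_mxEr _ 1 1 n).
rewrite (_ : _ \o _ = fst); first exact: measurable_fst.
apply/funext => p; rewrite /rV_coord /rV_cons/=.
rewrite (_ : ord0 = lshift n (ord0 : 'I_1)); last exact: ord_inj.
by rewrite (@row_mxEl _ 1 1 n) mxE eqxx mulr1n.
Qed.

Definition rV_uncons n (v : 'rV[R]_n.+1) : R * 'rV[R]_n :=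
  (v ord0 ord0, \row_i v ord0 (lift ord0 i)).

Lemma rV_consK n : cancel (@rV_cons n) (@rV_uncons n).
Proof.
move=> [x v]; rewrite /rV_uncons /rV_cons; congr (_, _).
  rewrite (_ : ord0 = lshift n (ord0 : 'I_1)); last exact: ord_inj.
  by rewrite (@row_mxEl _ 1 1 n) mxE eqxx mulr1n.
apply/rowP => j; rewrite mxE.
rewrite (_ : lift ord0 j = rshift 1 j); last exact: ord_inj.
exact: (@row_mxEr _ 1 1 n).
Qed.

Lemma measurable_rV_uncons n : measurable_fun setT (@rV_uncons n).
Proof.
apply: measurable_fun_pair; first exact: (measurable_rV_coord ord0).
apply: measurable_to_rV => i.
rewrite (_ : _ \o _ = rV_coord (lift ord0 i)); first exact: measurable_rV_coord.
by apply/funext => v; rewrite /rV_coord/= mxE.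
Qed.

(* Image on R^(1+n) of the product of one-dimensional Lebesgue measure with a
   measure on R^n. *)
Definition lebesgue_cons n
    (m : {sigma_finite_measure set 'rV[R]_n -> \bar R}) :
    set 'rV[R]_n.+1 -> \bar R :=
  pushforward (lebesgue_measure \x m)%E (@rV_cons n).

HB.instance Definition _ n
    (m : {sigma_finite_measure set 'rV[R]_n -> \bar R}) :=
  Measure.copy (lebesgue_cons m)
    (measure_function_pushforward__canonical__measure_function_Measure
       (lebesgue_measure \x m)%E (@measurable_rV_cons n)).

Lemma lebesgue_cons_sigma_finite n
    (m : {sigma_finite_measure set 'rV[R]_n -> \bar R}) :
  sigma_finite setT (lebesgue_cons m).
Proof.
have /sigma_finiteP[F [TF ndF Foo]] := sigma_finiteT (@lebesgue_measure R).
have /sigma_finiteP[G [TG ndG Goo]] := sigma_finiteT m.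
exists (fun k => @rV_uncons n @^-1` (F k `*` G k)).
  rewrite -preimage_bigcup (_ : \bigcup_k _ = setT) ?preimage_setT//.
  rewrite -subTset => -[x y] _.
  have [k _ Fkx] : (\bigcup_k F k) x by rewrite -TF.
  have [l _ Gly] : (\bigcup_k G k) y by rewrite -TG.
  exists (maxn k l) => //; split => /=.
    by move: x Fkx; exact/subsetPset/ndF/leq_maxl.
  by move: y Gly; exact/subsetPset/ndG/leq_maxr.
move=> k; have [mF Fk] := Foo k; have [mG Gk] := Goo k; split.
  rewrite -[X in measurable X]setTI.
  by apply: measurable_rV_uncons => //; exact: measurableX.
rewrite /lebesgue_cons /pushforward -comp_preimage.
rewrite (_ : _ \o _ = idfun) ?preimage_id; last first.
  by apply/funext => p; exact: rV_consK.
by rewrite product_measure1E// lte_mul_pinfty// ge0_fin_numE.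
Qed.

HB.instance Definition _ n
    (m : {sigma_finite_measure set 'rV[R]_n -> \bar R}) :=
  Measure_isSigmaFinite.Build _ _ _ (lebesgue_cons m)
    (lebesgue_cons_sigma_finite m).

Fixpoint lebesgue_rV (n : nat) :
    {sigma_finite_measure set 'rV[R]_n -> \bar R} :=
  match n return {sigma_finite_measure set 'rV[R]_n -> \bar R} with
  | 0 => \d_(0 : 'rV[R]_0)
  | m.+1 => lebesgue_cons (lebesgue_rV m)
  end.

End lebesgue_rV.

Arguments lebesgue_rV {R} n.

Section sobolev.
Context {R : realType} {n : nat}.
Implicit Types (Omega : set 'rV[R]_n) (phi : 'rV[R]_n -> R).
Implicit Types (u : 'rV[R]_n -> 'rV[R]_n) (g : 'rV[R]_n -> 'M[R]_n).

Local Notation mu := (lebesgue_rV n : {measure set 'rV[R]_n -> \bar R}).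

(* Elements of Lebesgue and Sobolev spaces are represented by everywhere
   defined functions that are Borel measurable on Omega (every class has such a
   representative); only the values on Omega matter, up to null sets. *)

Definition L2 Omega (f : 'rV[R]_n -> R) : Prop :=
  measurable_fun Omega f /\
  (\int[mu]_(x in Omega) (`|f x| ^+ 2)%:E < +oo)%E.

Definition L1_scalar Omega (f : 'rV[R]_n -> R) : Prop :=
  mu.-integrable Omega (EFin \o f).

Definition L1_vector Omega u : Prop :=
  forall i, L1_scalar Omega (fun x => u x ord0 i).

Definition partial (i : 'I_n) phi : 'rV[R]_n -> R :=
  fun x => 'D_(delta_mx ord0 i) phi x.

Definition smooth phi : Prop :=
  forall s : seq 'I_n, let psi := foldr partial phi s in
    continuous psi /\ forall i x, derivable psi x (delta_mx ord0 i).

Definition test_function Omega phi : Prop :=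
  [/\ smooth phi, compact (closure [set x | phi x != 0])
    & closure [set x | phi x != 0] `<=` Omega].

(* g x i j stands for the derivative of the i-th component of u along the
   j-th coordinate. *)
Definition is_weak_gradient Omega u g : Prop :=
  forall i j,
    L2 Omega (fun x => g x i j) /\
    forall phi, test_function Omega phi ->
      (\int[mu]_(x in Omega) (u x ord0 i * partial j phi x)%:E =
       - \int[mu]_(x in Omega) (g x i j * phi x)%:E)%E.

Definition H1 Omega u : Prop :=
  (forall i, L2 Omega (fun x => u x ord0 i)) /\
  exists g, is_weak_gradient Omega u g.

(* Only used for u in H1, where the weak gradient exists and is unique up to
   null sets. *)
Definition weak_gradient Omega u : 'rV[R]_n -> 'M[R]_n :=
  get (is_weak_gradient Omega u).

Definition sym_gradient Omega u (x : 'rV[R]_n) : 'M[R]_n :=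
  2^-1 *: (weak_gradient Omega u x + (weak_gradient Omega u x)^T).

End sobolev.

Section elasticity.
Context {R : realType} {n : nat}.
Implicit Types xi zeta : 'M[R]_n.

Definition symmetric_mx xi : Prop := xi^T = xi.

Definition frobenius xi zeta : R := \tr (xi *m zeta).

Definition frobenius_norm xi : R := Num.sqrt (frobenius xi xi).

(* A linear map on symmetric matrices is given by any linear extension to all
   matrices; only its values on symmetric matrices matter. *)
Definition elasticity_tensor (A : {linear 'M[R]_n -> 'M[R]_n}) : Prop :=
  (forall xi, symmetric_mx xi -> symmetric_mx (A xi)) /\
  (forall xi zeta, symmetric_mx xi -> symmetric_mx zeta ->
     frobenius (A xi) zeta = frobenius xi (A zeta)).

End elasticity.

Section functionals.
Context {R : realType} {n : nat}.
Variable Omega : set 'rV[R]_n.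
Implicit Types (u : 'rV[R]_n -> 'rV[R]_n) (chi : 'rV[R]_n -> R).

Local Notation mu := (lebesgue_rV n : {measure set 'rV[R]_n -> \bar R}).

(* Membership in L^oo(Omega; {0, 1}). *)
Definition phase_field chi : Prop :=
  measurable_fun Omega chi /\
  {ae mu, forall x, Omega x -> chi x = 0 \/ chi x = 1}.

Definition energy (Aw As : {linear 'M[R]_n -> 'M[R]_n}) (kappa : R)
    (eta : R -> R) (eps : R) u chi : \bar R :=
  if `[< H1 Omega u /\ phase_field chi >] then
    ((2^-1)%:E *
       (\int[mu]_(x in Omega)
          (frobenius
             ((eta eps * chi x) *: Aw (sym_gradient Omega u x)
              + (1 - chi x) *: As (sym_gradient Omega u x))
             (sym_gradient Omega u x))%:E)
     + (kappa / eps)%:E * \int[mu]_(x in Omega) (chi x)%:E)%E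
  else +oo%E.

Definition limit_functional (u : 'rV[R]_n -> 'rV[R]_n) chi : \bar R :=
  if `[< {ae mu, forall x, Omega x -> chi x = 0} >] then 0%E else +oo%E.

(* Families indexed by eps > 0 converging strongly in L^1 as eps -> 0. The norm
   on R^n is the supremum norm of the library; norms on R^n are equivalent. *)
Definition L1_converging (ueps : R -> 'rV[R]_n -> 'rV[R]_n)
    (chieps : R -> 'rV[R]_n -> R) u chi : Prop :=
  [/\ forall eps, 0 < eps ->
        L1_vector Omega (ueps eps) /\ L1_scalar Omega (chieps eps),
      (\int[mu]_(x in Omega) (`|ueps eps x - u x|)%:E @[eps --> 0^'+]
         --> 0)%E
    & (\int[mu]_(x in Omega) (`|chieps eps x - chi x|)%:E @[eps --> 0^'+]
         --> 0)%E].

Variable E : R -> ('rV[R]_n -> 'rV[R]_n) -> ('rV[R]_n -> R) -> \bar R.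

Definition Gamma_liminf u chi : \bar R :=
  ereal_inf [set l | exists ueps chieps, L1_converging ueps chieps u chi /\
    l = limf_einf (fun eps => E eps (ueps eps) (chieps eps)) 0^'+].

Definition Gamma_limsup u chi : \bar R :=
  ereal_inf [set l | exists ueps chieps, L1_converging ueps chieps u chi /\
    l = limf_esup (fun eps => E eps (ueps eps) (chieps eps)) 0^'+].

Definition Gamma_converges
    (Phi : ('rV[R]_n -> 'rV[R]_n) -> ('rV[R]_n -> R) -> \bar R) : Prop :=
  forall u chi, L1_vector Omega u -> L1_scalar Omega chi ->
    Gamma_liminf u chi = Phi u chi /\ Gamma_limsup u chi = Phi u chi.

End functionals.

(* Main.v *)
(* Off the set L of points within d of the faces of finitely many boxes, a step
   function can be replaced by a C^1 function w with vanishing gradient; on L the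
   gradient of w is of order 1/d and L has measure of order d. With chi the
   indicator of L the energy is of order eta/d + d/eps, which for
   d = sqrt(eta eps) equals 2 sqrt(eta/eps) and tends to 0. Step functions on
   boxes are dense in L^1 (Dynkin's lemma), so every u is an L^1 limit of
   displacements with vanishing energy; conversely the term (kappa/eps) int chi
   forces chi to vanish in the limit.
   The energy involves a chosen weak gradient, so its uniqueness almost
   everywhere is needed: test functions built from exp(-1/t) approximate
   indicators of boxes, and Dynkin's lemma applies again. *)
Require Import Defs.
From mathcomp Require Import all_boot all_order all_algebra.
From mathcomp Require Import all_classical all_reals all_analysis.
From mathcomp Require Import measurable_realfun ring lra.

Import Order.TTheory GRing.Theory Num.Theory.
Import numFieldNormedType.Exports.

Set Implicit Arguments.
Unset Strict Implicit.
Unset Printing Implicit Defensive.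

Local Open Scope classical_set_scope.
Local Open Scope ring_scope.

(** * Boxes and the Borel sigma-algebra of R^n *)

Section boxes.
Context {R : realType}.
Implicit Types n : nat.

(** In [recoverable] the constant [C] depends on the tolerance [tau] but not on the layer width [d]:
    a step function is fixed first, and only then are its layers thinned. This order of quantifiers
    makes the property stable under sums, multiples and L^1 limits, as Dynkin's lemma requires, and
    costs nothing in the energy, where [C] is a fixed factor of sqrt(eta/eps). The tolerance must
    still tend to 0 with eps; near minimizers of one combined cost take care of that. The bounds
    concern the full gradient, of which e(u) is a part, so the components of a displacement can be
    treated one at a time. Two obstacles come from the setting. The sigma-algebra of R^n is
    generated by the coordinates, so open sets have to be shown measurable, through rational balls
    of the sup norm, which are boxes. Integration by parts is derived from translation invariance
    and difference quotients, without iterated integrals. *)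

Definition box n (a b : 'rV[R]_n) : set 'rV[R]_n :=
  [set x | forall i, a ord0 i < x ord0 i < b ord0 i].

Lemma measurable_coordinatewise n (A : 'I_n -> set R) :
  (forall i, measurable (A i)) ->
  measurable [set x : 'rV[R]_n | forall i, A i (x ord0 i)].
Proof.
move=> mA.
have -> : [set x : 'rV[R]_n | forall i, A i (x ord0 i)] =
    \bigcap_(i in [set: 'I_n]) (rV_coord i @^-1` A i).
  by apply/seteqP; split => [x Ax i _|x Ax i]; [exact: Ax|exact: (Ax i Logic.I)].
apply: fin_bigcap_measurable => // i _.
by rewrite -[X in measurable X]setTI; exact: measurable_rV_coord.
Qed.

Lemma boxE n (a b : 'rV[R]_n) :
  box a b = [set x | forall i, `]a ord0 i, b ord0 i[%classic (x ord0 i)].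
Proof. by apply/seteqP; split => x xab i; have := xab i; rewrite /= in_itv. Qed.

Lemma measurable_box n (a b : 'rV[R]_n) : measurable (box a b).
Proof.
by rewrite boxE; exact: (measurable_coordinatewise (fun i => measurable_itv _)).
Qed.

Lemma boxI n (a b c d : 'rV[R]_n) : box a b `&` box c d =
  box (\row_i Order.max (a ord0 i) (c ord0 i))
      (\row_i Order.min (b ord0 i) (d ord0 i)).
Proof.
apply/seteqP; split => [x [xab xcd] i|x xI].
  rewrite !mxE gt_max lt_min; have /andP[-> ->] := xab i.
  by have /andP[-> ->] := xcd i.
by split=> i; have := xI i; rewrite !mxE gt_max lt_min => /andP[/andP[a1 a2] /andP[a3 a4]]; rewrite ?a1 ?a2 ?a3 ?a4.
Qed.

Lemma normr_rV_ltP n (x : 'rV[R]_n) (r : R) : 0 < r ->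
  `|x| < r <-> forall i, `|x ord0 i| < r.
Proof.
move=> r0; rewrite [`|x|]/Num.norm /= mx_normrE; split.
  move=> /bigmax_ltP[_ H] i; exact: (H (ord0, i)).
move=> H; apply/bigmax_ltP; split => // -[i j] _ /=.
by rewrite (ord1 i).
Qed.

Lemma ball_box n (x : 'rV[R]_n) (r : R) : 0 < r ->
  ball x r = box (x - const_mx r) (x + const_mx r).
Proof.
move=> r0; rewrite -ball_normE; apply/seteqP; split => y /=.
  move=> /(normr_rV_ltP _ r0) H i; have := H i; rewrite !mxE distrC ltr_distl.
  by [].
move=> H; apply/(normr_rV_ltP _ r0) => i; have := H i; rewrite !mxE distrC ltr_distl.
by [].
Qed.

(** The index type is countable, so unions of these balls are countable unions and null sets can be
    collected over them. The radius may be nonpositive, hence the side condition [0 < q.2] below. *)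
Definition rat_ball n (q : 'rV[rat]_n * rat) : set 'rV[R]_n :=
  ball (map_mx ratr q.1 : 'rV[R]_n) (ratr q.2).

(** Asking for the closure inside [U] is what later makes bumps supported in such a ball admissible
    test functions. *)
Lemma open_rat_ball n (U : set 'rV[R]_n) (x : 'rV[R]_n) : open U -> U x ->
  exists q : 'rV[rat]_n * rat,
    [/\ 0 < q.2, rat_ball q x & closure (rat_ball q) `<=` U].
Proof.
move=> oU Ux.
have /nbhs_ballP[/= e e0 xeU] : nbhs x U by exact: open_nbhs_nbhs.
(* A point [y] of the closure is reached from [x] through the centre and a nearby point of the ball,
   three distances below the radius; a radius under [e / 4] keeps their sum under [e]. *)
have e4 : 0 < e / 4 by rewrite divr_gt0.
have [r] := @rat_in_itvoo R 0 (e / 4) e4.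
rewrite in_itv /= => /andP[r0 re].
have /choice[c cP] : forall i : 'I_n, exists c : rat,
    `|x ord0 i - ratr c| < ratr r.
  move=> i; have [|c] := @rat_in_itvoo R (x ord0 i - ratr r) (x ord0 i + ratr r).
    by rewrite ltrBlDr -addrA ltrDl addr_gt0.
  rewrite in_itv /= => /andP[c1 c2]; exists c.
  by rewrite distrC ltr_distl c1.
have rr : 0 < r by rewrite -(ltr0q R).
exists (\row_i c i, r); split => //.
  rewrite /rat_ball -ball_normE /=; apply/normr_rV_ltP => // i.
  by rewrite !mxE distrC.
move=> y yc; apply: xeU.
have := yc (ball y (ratr r)); case.
  exact: nbhsx_ballx.
move=> z [zq yz].
rewrite /rat_ball -!ball_normE /= in zq yz *.
set p := map_mx _ _ in zq.
have xp : `|x - p| < ratr r.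
  by apply/normr_rV_ltP => // i; rewrite !mxE.
have -> : x - y = (x - p) + (p - z) - (y - z).
  by rewrite addrA subrK opprB addrA subrK.
rewrite (le_lt_trans (ler_normB _ _))//.
have := ler_normD (x - p) (p - z); move: re zq yz xp; lra.
Qed.

Lemma open_bigcup_rat_ball n (U : set 'rV[R]_n) : open U ->
  U = \bigcup_(q in [set q : 'rV[rat]_n * rat |
                      0 < q.2 /\ closure (rat_ball q) `<=` U]) rat_ball q.
Proof.
move=> oU; apply/seteqP; split => [x /(open_rat_ball oU)[q [q0 xq qU]]|].
  by exists q.
move=> x [q [q0 qU] xq]; apply: qU; exact: subset_closure.
Qed.

Lemma rat_ball_box n (q : 'rV[rat]_n * rat) : 0 < q.2 ->
  rat_ball q = box (map_mx ratr q.1 - const_mx (ratr q.2))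
                   (map_mx ratr q.1 + const_mx (ratr q.2)).
Proof. by move=> q0; rewrite /rat_ball ball_box// ltr0q. Qed.

Lemma bigcup_countType_measurable d (T : sigmaRingType d) (I : countType)
    (D : set I) (F : I -> set T) :
  (forall i, D i -> measurable (F i)) -> measurable (\bigcup_(i in D) F i).
Proof.
move=> mF.
have -> : \bigcup_(i in D) F i = \bigcup_k
    (if unpickle k is Some i then (if i \in D then F i else set0) else set0).
  apply/seteqP; split => [x [i Di Fi]|x [k _]].
    by exists (pickle i) => //; rewrite pickleK mem_set.
  case: unpickle => [i|//].
  by case: ifPn => //; rewrite inE => Di Fi; exists i.
apply: bigcupT_measurable => k; case: unpickle => [i|//].
by case: ifPn => //; rewrite inE; exact: mF.
Qed.

Lemma open_measurable_rV n (U : set 'rV[R]_n) : open U -> measurable U.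
Proof.
move=> oU; rewrite (open_bigcup_rat_ball oU).
apply: bigcup_countType_measurable => q [q0 _].
by rewrite rat_ball_box//; exact: measurable_box.
Qed.

Lemma continuous_measurable_rV n (f : 'rV[R]_n -> R) (D : set 'rV[R]_n) :
  measurable D -> continuous f -> measurable_fun D f.
Proof.
move=> mD cf; apply: measurable_funTS.
apply: (measurability _ (RGenOpens.measurableE R)).
move=> _ [_ [a [b ->]] <-]; rewrite setTI.
apply: open_measurable_rV; move/continuousP: cf; apply.
exact: interval_open.
Qed.

Definition boxes n : set (set 'rV[R]_n) := [set B | exists a b, B = box a b].

Lemma setI_closed_boxes n : setI_closed (@boxes n).
Proof.
by move=> _ _ [a [b ->]] [c [d ->]]; rewrite boxI; do 2!eexists.
Qed.

(** The form in which Dynkin induction is applied. The preimage of an interval under one coordinate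
    is a countable union of boxes whose other sides are ]-k, k[. *)
Lemma measurable_boxesE n : @measurable _ 'rV[R]_n = <<s @boxes n >>.
Proof.
apply/seteqP; split; last first.
  apply: smallest_sub; first exact: sigma_algebra_measurable.
  by move=> _ [a [b ->]]; exact: measurable_box.
apply: smallest_sub; first exact: smallest_sigma_algebra.
move=> B; rewrite -bigcup_seq/= => -[i _ [A mA <-]]; rewrite setTI {B}.
suff : @measurable _ R `<=` [set A | <<s @boxes n >> (rV_coord i @^-1` A)] by exact.
have [s0 sC sU] := smallest_sigma_algebra [set: 'rV[R]_n] (@boxes n).
have -> : @measurable _ R = <<s @RGenOpens.G R >> by exact: RGenOpens.measurableE.
apply: smallest_sub.
  split => /=.
  - by rewrite preimage_set0.
  - by move=> B mB; rewrite setTD preimage_setC -setTD; exact: sC.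
  - by move=> F mF; rewrite preimage_bigcup; exact: sU.
move=> _ [a [b ->]] /=.
rewrite (_ : rV_coord i @^-1` _ = \bigcup_k
   box (\row_j if j == i then a else - k%:R)
       (\row_j if j == i then b else k%:R)).
  apply: sU => k; apply: sub_sigma_algebra.
  by do 2!eexists.
apply/seteqP; split => [x|x [k _ xk]] /=; rewrite in_itv /=; last first.
  by have := xk i; rewrite !mxE eqxx.
move=> xab; exists (Num.truncn `|x|).+1 => // j; rewrite !mxE.
case: eqP => [->//|_]; rewrite -ltr_norml.
have x0 : 0 < (Num.truncn `|x|).+1%:R :> R by rewrite ltr0n.
by move: j; apply/normr_rV_ltP => //; exact: truncnS_gt.
Qed.

End boxes.

(** * Lebesgue measure on R^n *)

Section lebesgue_rV_theory.
Context {R : realType}.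
Implicit Types n : nat.
Local Open Scope ereal_scope.

Lemma rV_consE n (p : R * 'rV[R]_n) i : rV_cons p ord0 i =
  if unlift ord0 i is Some j then p.2 ord0 j else p.1.
Proof.
case: (unliftP ord0 i) => [j|] ->; rewrite /rV_cons.
  rewrite (_ : lift ord0 j = rshift 1 j); last exact: ord_inj.
  exact: (@row_mxEr _ 1 1 n).
rewrite (_ : ord0 = lshift n (ord0 : 'I_1)); last exact: ord_inj.
by rewrite (@row_mxEl _ 1 1 n) mxE eqxx mulr1n.
Qed.

Lemma lebesgue_rV_succE n (A : set 'rV[R]_n.+1) :
  lebesgue_rV n.+1 A = (lebesgue_measure \x lebesgue_rV n) (@rV_cons R n @^-1` A).
Proof. by []. Qed.

Lemma lebesgue_rV_prod n (A : 'I_n -> set R) : (forall i, measurable (A i)) ->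
  lebesgue_rV n [set x | forall i, A i (x ord0 i)] =
  \prod_(i < n) lebesgue_measure (A i).
Proof.
elim: n => [|n ih] in A *.
  move=> _; rewrite big_ord0 (_ : [set _ | _] = setT); first exact: diracT.
  by apply/seteqP; split => // x _ [].
move=> mA; rewrite lebesgue_rV_succE big_ord_recl -ih; last by move=> i; exact: mA.
rewrite -product_measure1E; [|exact: mA|]; last exact: (measurable_coordinatewise (fun i => mA (lift ord0 i))).
congr (product_measure1 _ _ _); apply/seteqP; split => [[x y] /= H|[x y] /= [H0 H] i].
  split => [|i]; first by have := H ord0; rewrite rV_consE unlift_none.
  by have := H (lift ord0 i); rewrite rV_consE liftK.
by rewrite rV_consE; case: unliftP => [j ->|->].
Qed.

(** The pushforward by the translation agrees with Lebesgue measure on half-open intervals, and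
    these determine the measure. *)
Lemma lebesgue_measure_translation (c : R) (A : set R) : measurable A ->
  lebesgue_measure ((fun x => x + c)%R @^-1` A) = lebesgue_measure A.
Proof.
move=> mA; apply/esym.
have mc : measurable_fun [set: measurableTypeR R] ((fun x => x + c)%R : _ -> measurableTypeR R).
  exact: measurable_funD.
rewrite -[RHS]/(pushforward lebesgue_measure ((fun x => x + c)%R : measurableTypeR R -> measurableTypeR R) A).
apply/lebesgue_measure_unique => //= _ [[a b]] _ <-.
rewrite /pushforward (_ : _ @^-1` _ = `](a - c)%R, (b - c)%R]%classic).
  rewrite !lebesgue_measure_itv/= !lte_fin ltrD2r; case: ifPn => // _.
  by rewrite -!EFinB; congr EFin; ring.
by apply/seteqP; split => x /=; rewrite !in_itv /= ltrBlDr lerBrDr.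
Qed.

Lemma measurable_rV_addr n (v : 'rV[R]_n) :
  measurable_fun setT (fun x : 'rV[R]_n => x + v)%R.
Proof.
apply: measurable_to_rV => i.
rewrite (_ : _ \o _ = (fun x => rV_coord i x + v ord0 i)%R).
  by apply: measurable_funD => //; exact: measurable_rV_coord.
by apply/funext => x; rewrite /rV_coord /= mxE.
Qed.

(** Induction on the dimension. Read through [rV_cons], the translation acts separately on the first
    coordinate and on the rest, so uniqueness of the product measure reduces the claim to
    rectangles. *)
Lemma lebesgue_rV_translation n (v : 'rV[R]_n) (A : set 'rV[R]_n) :
  measurable A -> lebesgue_rV n ((fun x => x + v)%R @^-1` A) = lebesgue_rV n A.
Proof.
elim: n => [|n ih] in v A *.
  move=> _; congr (lebesgue_rV 0 _); apply/seteqP.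
  by split => x /=; rewrite [v]thinmx0 addr0.
move=> mA; rewrite !lebesgue_rV_succE.
pose S (p : measurableTypeR R * 'rV[R]_n) : measurableTypeR R * 'rV[R]_n :=
  (p.1 + v ord0 ord0, p.2 + (rV_uncons v).2)%R.
have mS : measurable_fun setT S.
  apply: measurable_fun_pair; first by apply: measurable_funD => //; exact: measurable_fst.
  exact: (measurableT_comp (measurable_rV_addr _) measurable_snd).
have -> : @rV_cons R n @^-1` ((fun x => x + v)%R @^-1` A) = S @^-1` (@rV_cons R n @^-1` A).
  apply/funext => p; congr A; apply/rowP => i; rewrite mxE (rV_consE p) (rV_consE (S p)).
  by case: unliftP => [j ->|->]; rewrite ?mxE.
have mB : measurable (@rV_cons R n @^-1` A).
  by rewrite -[X in measurable X]setTI; exact: measurable_rV_cons.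
rewrite -[LHS]/(pushforward (lebesgue_measure \x lebesgue_rV n) S _).
apply/esym/product_measure_unique => // C D mC mD.
transitivity ((lebesgue_measure \x lebesgue_rV n)
  (((fun x => x + v ord0 ord0)%R @^-1` C) `*` ((fun x => x + (rV_uncons v).2)%R @^-1` D))) => //.
rewrite product_measure1E.
- by rewrite ih//; congr (_ * _); exact: lebesgue_measure_translation.
- have mc : measurable_fun setT (fun x : R => x + v ord0 ord0)%R by apply: measurable_funD.
  rewrite -[X in measurable X]setTI; exact: (mc measurableT C mC).
- by rewrite -[X in measurable X]setTI; exact: measurable_rV_addr.
Qed.

End lebesgue_rV_theory.

(** * Integrals of partial derivatives *)

Section bounded_sets.
Context {R : realType} {n : nat}.
Local Notation mu := (lebesgue_rV n : {measure set 'rV[R]_n -> \bar R}).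

Lemma box_lty (a b : 'rV[R]_n) : (mu (box a b) < +oo)%E.
Proof.
have fin : (\prod_(i < n) lebesgue_measure `]a ord0 i, b ord0 i[%classic)%E \is a @fin_num R.
  elim/big_ind : _ => // [x y|i _]; first exact: fin_numM.
  by rewrite lebesgue_measure_itv/=; case: ifP.
have -> : mu (box a b) = (\prod_(i < n) lebesgue_measure `]a ord0 i, b ord0 i[%classic)%E.
  rewrite boxE; exact: (lebesgue_rV_prod (fun i => measurable_itv `]a ord0 i, b ord0 i[)).
by rewrite ltey; case/fin_numP: fin.
Qed.

Definition cube (r : R) : set 'rV[R]_n := box (const_mx (- r)) (const_mx r).

Lemma cubeP r x : 0 < r -> cube r x <-> `|x| < r.
Proof.
move=> r0; split => [H|/normr_rV_ltP H i].
  by apply/normr_rV_ltP => // i; have := H i; rewrite !mxE ltr_norml.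
by rewrite !mxE -ltr_norml H.
Qed.

Lemma bounded_set_cube (A : set 'rV[R]_n) : bounded_set A ->
  exists2 r, 0 < r & A `<=` cube r.
Proof.
move=> [M [_ HM]]; exists (`|M| + 2).
  by rewrite ltr_wpDl.
move=> x Ax; apply/cubeP; first by rewrite ltr_wpDl.
have := HM (`|M| + 1); rewrite (le_lt_trans (ler_norm M)) ?ltrDl// => /(_ isT x Ax) /= xM.
by rewrite (le_lt_trans xM)// ltrD2l ltr1n.
Qed.

Lemma bounded_set_lty (A : set 'rV[R]_n) : measurable A -> bounded_set A ->
  (mu A < +oo)%E.
Proof.
move=> mA /bounded_set_cube[r r0 Ar]; apply: le_lt_trans (box_lty (const_mx (- r)) (const_mx r)).
by apply: le_measure => //; rewrite inE//; exact: measurable_box.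
Qed.

End bounded_sets.

Section translation_invariance.
Context {R : realType} {n : nat}.
Local Notation mu := (lebesgue_rV n : {measure set 'rV[R]_n -> \bar R}).

Lemma harmonic_dnbhs : (k.+1%:R^-1 : R) @[k --> \oo] --> 0^'.
Proof.
move=> A /(@cvg_harmonic R) [N _ NA]; exists N => // k /NA /=; apply.
by rewrite /harmonic/= invr_eq0 pnatr_eq0.
Qed.

(** Invariance passes from sets to integrals because the pushforward of [mu] by the translation has
    the same values as [mu] on measurable sets. *)
Lemma integrable_translation (f : 'rV[R]_n -> R) (v : 'rV[R]_n) :
  measurable_fun setT f -> mu.-integrable setT (EFin \o f) ->
  mu.-integrable setT (fun x : 'rV[R]_n => (f (x + v))%:E) /\
  (\int[mu]_x (f (x + v))%:E = \int[mu]_x (f x)%:E)%E.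
Proof.
move=> mf intf.
pose tau (x : 'rV[R]_n) : 'rV[R]_n := x + v.
have mT : measurable_fun setT tau by exact: measurable_rV_addr.
have mE : measurable_fun setT (EFin \o f) by exact/measurable_EFinP.
have mfv : measurable_fun setT (fun x : 'rV[R]_n => (f (x + v))%:E).
  exact: (measurableT_comp mE mT).
have eqm A : measurable A -> pushforward mu tau A = mu A.
  exact: lebesgue_rV_translation.
have intfv : mu.-integrable setT (fun x : 'rV[R]_n => (f (x + v))%:E).
  apply/integrableP; split => //.
  have /integrableP[_] := intf; apply: le_lt_trans.
  rewrite le_eqVlt; apply/orP; left; apply/eqP.
  transitivity (\int[pushforward mu tau]_(y in setT) `|(f y)%:E|)%E.
    rewrite ge0_integral_pushforward ?preimage_setT//.
    by apply: measurableT_comp => //.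
  by apply: eq_measure_integral => A mA _; exact: eqm.
split => //.
transitivity (\int[pushforward mu tau]_(y in setT) (f y)%:E)%E.
  by rewrite integral_pushforward ?preimage_setT.
by apply: eq_measure_integral => A mA _; exact: eqm.
Qed.

End translation_invariance.

Section integral_partial.
Context {R : realType} {n : nat}.
Local Notation mu := (lebesgue_rV n : {measure set 'rV[R]_n -> \bar R}).
Variables (w : 'rV[R]_n -> R) (j : 'I_n) (M0 M r : R).
Let e : 'rV[R]_n := delta_mx ord0 j.
Hypothesis dw : forall x, derivable w x e.
Hypothesis w_ub : forall x, `|w x| <= M0.
Hypothesis dw_ub : forall x, `|partial j w x| <= M.
Hypothesis mw : measurable_fun setT w.
Hypothesis r0 : 0 < r.
Hypothesis w0 : forall x, ~ cube r x -> w x = 0.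

Lemma is_derive_line (x : 'rV[R]_n) (t : R) :
  is_derive t (1:R) (fun s : R => w (x + s *: e)) (partial j w (x + t *: e)).
Proof.
have E : (fun h : R => h^-1 *: (((fun s : R => w (x + s *: e)) \o shift t) (h *: 1)
       - w (x + t *: e))) =
    (fun h => h^-1 *: ((w \o shift (x + t *: e)) (h *: e) - w (x + t *: e))).
  apply/funext => h /=; congr (_ *: (w _ - _)).
  by rewrite [h *: 1]mulr1 scalerDl addrCA.
by apply: DeriveDef; rewrite /derivable /partial /derive E //; exact: dw.
Qed.

(** The mean value theorem on a line parallel to [e]; it provides a bound on the difference
    quotients that does not depend on the step. *)
Lemma line_lipschitz x h : 0 <= h -> `|w (x + h *: e) - w x| <= M * h.
Proof.
move=> h0.
have cont : {within `[0, h], continuous (fun s : R => w (x + s *: e))}.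
  apply: derivable_within_continuous => t _.
  by have [] := is_derive_line x t.
have [c _] := MVT_segment h0 (fun t _ => is_derive_line x t) cont.
rewrite scale0r addr0 subr0 => ->; rewrite normrM (ger0_norm h0).
by rewrite ler_wpM2r.
Qed.

Let M_ge0 : 0 <= M.
Proof. exact: le_trans (dw_ub 0). Qed.

Lemma integrable_cube (f : 'rV[R]_n -> R) (s K : R) : measurable_fun setT f ->
  (forall x, `|f x| <= K) -> (forall x, ~ cube s x -> f x = 0) ->
  mu.-integrable setT (EFin \o f).
Proof.
move=> mf fK f0.
have mc : measurable (cube s : set 'rV[R]_n) by exact: measurable_box.
apply: (@le_integrable _ _ _ _ _ measurableT _ (EFin \o (fun x => K * \1_(cube s) x))).
- exact/measurable_EFinP.
- move=> x _ /=; rewrite lee_fin; have [xs|xs] := pselect (cube s x).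
    rewrite indicE mem_set// mulr1; exact: le_trans (fK x) (ler_norm _).
  by rewrite f0// normr0.
- apply: (@eq_integrable _ _ _ _ _ measurableT (fun x => K%:E * (\1_(cube s) x)%:E)%E).
    by move=> x _ /=; rewrite EFinM.
  apply: integrableZl => //; apply/integrableP; split.
    exact/measurable_EFinP.
  rewrite (eq_integral (fun x => (\1_(cube s) x)%:E)).
    by rewrite integral_indic// setIT; exact: box_lty.
  by move=> x _; rewrite gee0_abs// lee_fin.
Qed.

Let w_int : mu.-integrable setT (EFin \o w).
Proof. exact: integrable_cube w_ub w0. Qed.

Let dq k (x : 'rV[R]_n) : R := k.+1%:R * (w (x + k.+1%:R^-1 *: e) - w x).

Let mdq k : measurable_fun setT (dq k).
Proof.
apply: measurable_funM => //; apply: measurable_funB => //.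
exact: (measurableT_comp mw (measurable_rV_addr _)).
Qed.

(** The integrable majorant for dominated convergence. Steps have length at most 1, so a quotient
    can be nonzero only at distance less than 1 from the cube that carries [w]: hence [r + 1]. *)
Let dq_ub k (x : 'rV[R]_n) : `|dq k x| <= M * \1_(cube (r + 1)) x.
Proof.
have k0 : 0 < k.+1%:R :> R by rewrite ltr0n.
have k1 : `|k.+1%:R^-1 : R| <= 1.
  by rewrite ger0_norm ?invr_ge0 ?ler0n// invf_le1// ler1n.
have r10 : 0 < r + 1 by rewrite addr_gt0.
have [xr|xr] := pselect (cube (r + 1) x).
  rewrite indicE mem_set// mulr1 /dq normrM (ger0_norm (ltW k0)) mulrC.
  rewrite -ler_pdivlMr//; apply: line_lipschitz.
  by rewrite invr_ge0 ltW.
rewrite indicE memNset// mulr0 /dq !w0 ?subrr ?mulr0 ?normr0//.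
  by move=> /(cubeP _ r0) xr'; apply: xr; apply/cubeP => //; rewrite (lt_trans xr')// ltrDl.
move=> /(cubeP _ r0) xr'; apply: xr; apply/cubeP => //.
rewrite -[x](addrK (k.+1%:R^-1 *: e)) (le_lt_trans (ler_normB _ _))// ltr_leD//.
rewrite normrZ mulr_ile1// /e [`|_|]/Num.norm /= mx_normrE; apply/bigmax_leP; split => // -[a b] _ /=.
by rewrite mxE; case: (_ && _); rewrite ?normr1 ?normr0.
Qed.

Let dq_cvg (x : 'rV[R]_n) : dq k x @[k --> \oo] --> partial j w x.
Proof.
have dwx : (h^-1 *: ((w \o shift x) (h *: e) - w x)) @[h --> 0^'] --> partial j w x.
  exact: dw.
have := cvg_comp _ _ harmonic_dnbhs dwx.
apply: cvg_trans; apply: near_eq_cvg; near=> k => /=.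
by rewrite /dq invrK [_ + x]addrC.
Unshelve. all: by end_near. Qed.

(* The difference quotients have integral 0 by translation invariance. *)
Lemma integral_partial_eq0 : (\int[mu]_x (partial j w x)%:E = 0)%E.
Proof.
have mdwE : measurable_fun setT (EFin \o partial j w).
  apply: (emeasurable_fun_cvg (fun k => EFin \o dq k)).
    by move=> k; exact/measurable_EFinP.
  by move=> x _; apply: cvg_EFin; [exact: nearW|exact: dq_cvg].
have intg : mu.-integrable setT (EFin \o (fun x => M * \1_(cube (r + 1)) x)).
  apply: (@integrable_cube _ (r + 1) M).
  - by apply: measurable_funM => //; apply: measurable_indic; exact: measurable_box.
  - move=> x; rewrite indicE; case: (_ \in _); rewrite ?mulr1 ?mulr0 ?normr0//.
    by rewrite ger0_norm.
  - by move=> x xr; rewrite indicE memNset// mulr0.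
have mdqE k : measurable_fun setT (EFin \o dq k) by exact/measurable_EFinP.
have cvgE : {ae mu, forall x, setT x -> (EFin \o dq k) x @[k --> \oo] --> (EFin \o partial j w) x}.
  by apply: aeW => x _; apply: cvg_EFin; [exact: nearW|exact: dq_cvg].
have ubE : {ae mu, forall x, forall k, setT x ->
    (`|(EFin \o dq k) x| <= (EFin \o (fun x => M * \1_(cube (r + 1)) x)%R) x)%E}.
  by apply: aeW => x k _; rewrite /= lee_fin; exact: dq_ub.
have [_ _] := dominated_convergence measurableT mdqE mdwE cvgE intg ubE.
rewrite (_ : [sequence _]_n = fun=> 0%E); last first.
  apply/funext => k /=.
  have [i1 i2] := integrable_translation (k.+1%:R^-1 *: e) mw w_int.
  under eq_integral do rewrite /dq EFinM EFinB.
  rewrite integralZl//; last exact: integrableB.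
  rewrite integralB_EFin// i2 subee ?mule0//.
  exact: integrable_fin_num.
by move=> /(cvg_lim (@ereal_hausdorff R)) <-; exact: lim_cst.
Qed.

End integral_partial.

(** * Test functions supported in boxes *)

Section flat_function.
Context {R : realType}.

(** The classical flat function exp(-1/x) together with its multiples by powers of 1/x: the span of
    the family is stable under differentiation. *)
Definition flat (k : nat) (x : R) : R :=
  if 0 < x then x^-1 ^+ k * expR (- x^-1) else 0.

Lemma flat_le0 k x : x <= 0 -> flat k x = 0.
Proof. by rewrite /flat ltNge => ->. Qed.

Lemma flat_gt0 k x : 0 < x -> flat k x = x^-1 ^+ k * expR (- x^-1).
Proof. by rewrite /flat => ->. Qed.

Lemma flat_ge0 k x : 0 <= flat k x.
Proof.
rewrite /flat; case: ifPn => // x0.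
by rewrite mulr_ge0 ?expR_ge0// exprn_ge0// invr_ge0 ltW.
Qed.

Lemma flat0_le1 x : flat 0 x <= 1.
Proof.
rewrite /flat; case: ifPn => // x0.
by rewrite expr0 mul1r -expR0 ler_expR oppr_le0 invr_ge0 ltW.
Qed.

(** One term of the exponential series, exp(y) >= y^(k+1)/(k+1)! at y = 1/x, already beats x^(-k)
    with a factor x to spare. This controls the limit at 0. *)
Lemma flat_le k x : flat k x <= (k.+1)`!%:R * `|x|.
Proof.
have [x0|x0] := leP x 0; first by rewrite flat_le0// mulr_ge0.
have y0 : 0 <= x^-1 by rewrite invr_ge0 ltW.
rewrite flat_gt0// gtr0_norm// expRN ler_pdivrMr ?expR_gt0//.
have := @expR_ge1Dxn R _ k y0 => H.
have f0 : 0 < (k.+1)`!%:R :> R by rewrite ltr0n fact_gt0.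
have {}H : x^-1 ^+ k.+1 <= (k.+1)`!%:R * expR x^-1.
  by rewrite mulrC -ler_pdivrMr// (le_trans _ H)// lerDr.
have -> : x^-1 ^+ k = x^-1 ^+ k.+1 * x by rewrite exprSr mulfVK// gt_eqF.
by rewrite mulrAC ler_pM2r.
Qed.

Lemma is_derive_flat k x :
  is_derive x (1 : R) (flat k) (flat k.+2 x - k%:R * flat k.+1 x).
Proof.
have [x0|x0|->] := ltrgtP x 0.
- rewrite !flat_le0 ?ltW// mulr0 subrr.
  apply: (@near_eq_is_derive _ _ _ (cst 0)).
  by near=> y; rewrite flat_le0//; apply/ltW; near: y; apply: open_nbhs_nbhs; split => //; exact: open_lt.
- have dV : is_derive x (1:R) (fun y : R => y^-1) (- x ^- 2 *: 1).
    by apply: is_deriveV; rewrite gt_eqF.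
  have dE : is_derive x (1:R) (fun y : R => expR (- y^-1)) (expR (- x^-1) * (x ^- 2)).
    apply: (@is_derive1_comp _ expR (fun y => - y^-1)).
    have := is_deriveN dV; rewrite scaleNr opprK [_ *: _]mulr1; exact.
  have fE : \near x, ((fun y : R => y^-1) ^+ k * (fun y : R => expR (- y^-1)))%R x = flat k x.
    near=> y; rewrite flat_gt0 ?exprfctE//; near: y.
    by apply: open_nbhs_nbhs; split => //; exact: open_gt.
  have H := near_eq_is_derive fE (is_deriveM (is_deriveX k dV) dE).
  apply: is_derive_eq H _.
  rewrite !flat_gt0// !exprfctE -exprVn !scalerAl !/GRing.scale/=.
  by case: k {fE} => [|k]/=; rewrite !exprS; ring.
- rewrite !flat_le0// mulr0 subrr.
  (* At the origin the difference quotient of [flat k] is [flat k.+1] itself, which [flat_le]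
     squeezes to 0. *)
  have lim0 : (h^-1 *: ((flat k \o shift 0) (h *: 1) - flat k 0)) @[h --> 0^'] --> (0 : R).
    apply: (@cvg_trans _ (flat k.+1 @ 0^')).
      apply: near_eq_cvg; near=> h; rewrite /= [flat k 0]flat_le0// subr0 addr0 [h *: 1]mulr1.
      rewrite /flat; case: ifPn; rewrite ?scaler0// => h0.
      by rewrite [_ *: _]mulrA -exprS.
    apply: cvg_within_filter.
    apply: (@squeeze_cvgr _ _ _ _ (fun=> 0) (fun h => (k.+2)`!%:R * `|h|)).
    + by near=> h; rewrite flat_ge0 flat_le.
    + exact: cvg_cst.
    + rewrite -[X in _ --> X](mulr0 (k.+2)`!%:R) -{2}(@normr0 R R).
      by apply: cvgMr; apply: cvg_norm; exact: cvg_id.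
  apply: DeriveDef; first by apply/cvg_ex; exists 0.
  exact: cvg_lim lim0.
Unshelve. all: by end_near. Qed.

End flat_function.

Section bumps.
Context {R : realType}.

(* A class closed under differentiation, so that smoothness needs no Leibniz
   formula for higher derivatives. *)
Inductive bump_span (m a b : R) : (R -> R) -> Prop :=
| bump_span_base c k l :
    bump_span m a b (fun x => c * (flat k (m * (x - a)) * flat l (m * (b - x))))
| bump_span_add f g : bump_span m a b f -> bump_span m a b g ->
    bump_span m a b (fun x => f x + g x).

Lemma is_derive_affine (m a x : R) : is_derive x (1:R) (fun y => m * (y - a)) m.
Proof.
have H1 : is_derive x (1:R) (fun y : R => y - a) 1 by exact: (is_derive_shift x 1 (- a)).
by have := is_deriveZ m H1; rewrite [m *: 1]mulr1.
Qed.

(** By the product rule a generator yields four generators, with one exponent raised by one or two;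
    the inner derivatives [m] and [- m] go into the coefficients. *)
Lemma bump_span_derive m a b f : bump_span m a b f ->
  exists2 f', bump_span m a b f' & forall x, is_derive x (1:R) f (f' x).
Proof.
elim=> [c k l|{}f g _ [f' Sf' df] _ [g' Sg' dg]]; last first.
  exists (fun x => f' x + g' x); first exact: bump_span_add.
  by move=> x; exact: is_deriveD.
pose p k l x : R := flat k (m * (x - a)) * flat l (m * (b - x)).
exists (fun x => (c * m * p k.+2 l x + (- (c * m * k%:R)) * p k.+1 l x) +
   ((- (c * m)) * p k l.+2 x + (c * m * l%:R) * p k l.+1 x)).
  by do 2 apply: bump_span_add; exact: bump_span_base.
move=> x.
have d1 : is_derive x (1:R) (fun y => flat k (m * (y - a)))
    ((flat k.+2 (m * (x - a)) - k%:R * flat k.+1 (m * (x - a))) * m).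
  apply: (@is_derive1_comp _ (flat k) (fun y => m * (y - a))); first exact: is_derive_flat.
  exact: is_derive_affine.
have d2 : is_derive x (1:R) (fun y => flat l (m * (b - y)))
    ((flat l.+2 (m * (b - x)) - l%:R * flat l.+1 (m * (b - x))) * - m).
  apply: (@is_derive1_comp _ (flat l) (fun y => m * (b - y))); first exact: is_derive_flat.
  have := is_derive_affine (- m) b x; congr is_derive.
  by apply/funext => y; rewrite mulNr -mulrN opprB.
have := is_deriveZ c (is_deriveM d1 d2).
move=> H; apply: is_derive_eq H _; rewrite /p /GRing.scale/=; ring.
Qed.

Lemma bump_span_supp m a b f x : 0 <= m -> bump_span m a b f ->
  ~ (a < x < b) -> f x = 0.
Proof.
move=> m0 Sf; elim: Sf => [c k l|{}f g _ IHf _ IHg] xab; last first.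
  by rewrite IHf// IHg// addr0.
have [ax|xa] := ltP a x; last by rewrite flat_le0 ?mul0r ?mulr0// mulr_ge0_le0// subr_le0.
have [xb|bx] := ltP x b; first by exfalso; apply: xab; rewrite ax xb.
by rewrite [flat l _]flat_le0 ?mulr0// mulr_ge0_le0// subr_le0.
Qed.

End bumps.

(** * Products of functions of one coordinate *)

Section tensors.
Context {R : realType} {n : nat}.

Definition tensor (f : 'I_n -> R -> R) (x : 'rV[R]_n) : R :=
  \prod_i f i (x ord0 i).

Definition subst_factor (f : 'I_n -> R -> R) (j : 'I_n) (g : R -> R) :=
  fun i => if i == j then g else f i.

(** Along the [j]-th direction a single factor varies and the others form a constant [K], so a
    one-dimensional derivative is enough. *)
Lemma is_derive_tensor (f : 'I_n -> R -> R) (j : 'I_n) (g : R -> R) (x : 'rV[R]_n) :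
  is_derive (x ord0 j) (1:R) (f j) (g (x ord0 j)) ->
  is_derive x (delta_mx ord0 j : 'rV[R]_n) (tensor f) (tensor (subst_factor f j g) x).
Proof.
move=> [df dfE].
pose K := \prod_(i | i != j) f i (x ord0 i).
have tE h : tensor f (h *: delta_mx ord0 j + x) = f j (h + x ord0 j) * K.
  rewrite /tensor (bigD1 j)//= !mxE !eqxx mulr1; congr (_ * _).
  by apply: eq_bigr => i ij; rewrite !mxE eqxx (negbTE ij) mulr0 add0r.
have t'E : tensor (subst_factor f j g) x = g (x ord0 j) * K.
  rewrite /tensor (bigD1 j)//= /subst_factor eqxx; congr (_ * _).
  by apply: eq_bigr => i ij; rewrite (negbTE ij).
have cv : (h^-1 *: ((tensor f \o shift x) (h *: delta_mx ord0 j) - tensor f x)) @[h --> 0^']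
    --> tensor (subst_factor f j g) x.
  have H : (h^-1 *: ((f j \o shift (x ord0 j)) (h *: 1) - f j (x ord0 j))) @[h --> 0^']
      --> g (x ord0 j).
    by rewrite -dfE; exact: df.
  rewrite t'E; apply: cvg_trans (cvgM H (cvg_cst K)); apply: near_eq_cvg.
  apply: nearW => h /=; rewrite tE.
  have := tE 0; rewrite scale0r !add0r => ->.
  by rewrite [h *: 1]mulr1 -mulrBl scalerAl.
by apply: DeriveDef; [apply/cvg_ex; eexists; exact: cv|exact: cvg_lim cv].
Qed.

Lemma continuous_rV_coord (i : 'I_n) : continuous (fun x : 'rV[R]_n => x ord0 i).
Proof. exact: coord_continuous. Qed.

Lemma continuous_tensor (f : 'I_n -> R -> R) :
  (forall i, continuous (f i)) -> continuous (tensor f).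
Proof.
move=> cf; apply: continuous_big => [|i _ x]; first exact: mul_continuous.
apply: continuous_comp; first exact: continuous_rV_coord.
exact: cf.
Qed.

End tensors.

Section test_functions.
Context {R : realType} {n : nat}.

(** The literal [1 *] makes every factor an instance of [bump_span_base]. Increasing [m] leaves the
    support inside the box and drives the value towards 1 there. *)
Definition bump (m : R) (a b : 'rV[R]_n) : 'rV[R]_n -> R :=
  tensor (fun i t => 1 * (flat 0 (m * (t - a ord0 i)) * flat 0 (m * (b ord0 i - t)))).

Lemma tensor_bump_span_derive (m : R) (a b : 'rV[R]_n) f :
  (forall i, bump_span m (a ord0 i) (b ord0 i) (f i)) -> forall j,
  exists g, [/\ (forall i, bump_span m (a ord0 i) (b ord0 i) (g i)),
     partial j (tensor f) = tensor g &
     forall x : 'rV[R]_n, derivable (tensor f) x (delta_mx ord0 j)].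
Proof.
move=> Sf j; have [g Sg dg] := bump_span_derive (Sf j).
exists (subst_factor f j g); split.
- by move=> i; rewrite /subst_factor; case: eqP => [->|].
- apply/funext => x; have [_] := is_derive_tensor (dg (x ord0 j)).
  exact.
- by move=> x; have [] := is_derive_tensor (dg (x ord0 j)).
Qed.

Lemma continuous_bump_span (m a b : R) f : bump_span m a b f -> continuous f.
Proof.
move=> /bump_span_derive[g _ dg] x.
apply: differentiable_continuous; apply/derivable1_diffP.
by have [] := dg x.
Qed.

(** Each partial derivative replaces one factor by another member of its span, so every iterated
    derivative is again such a product, hence continuous and differentiable in each coordinate
    direction. *)
Lemma smooth_tensor_bump_span (m : R) (a b : 'rV[R]_n) f :
  (forall i, bump_span m (a ord0 i) (b ord0 i) (f i)) -> smooth (tensor f).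
Proof.
move=> Sf s.
have [g Sg ->] : exists2 g, (forall i, bump_span m (a ord0 i) (b ord0 i) (g i)) &
    foldr partial (tensor f) s = tensor g.
  elim: s => [|j s [g Sg gE]]; first by exists f.
  have [g' [Sg' g'E _]] := tensor_bump_span_derive Sg j.
  by exists g' => //; rewrite /= gE.
split; first by apply: continuous_tensor => i; exact: continuous_bump_span (Sg i).
by move=> j x; have [g' [_ _]] := tensor_bump_span_derive Sg j.
Qed.

Lemma bump_notin m (a b x : 'rV[R]_n) : 0 <= m -> ~ box a b x -> bump m a b x = 0.
Proof.
move=> m0 /existsNP[i xab]; rewrite /bump /tensor (bigD1 i)//=.
by rewrite (bump_span_supp m0 (bump_span_base _ _ _ _ _ _) xab) mul0r.
Qed.

Lemma box_sub_compact (a b : 'rV[R]_n) : exists2 K, compact K & box a b `<=` K.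
Proof.
pose A (i : 'I_n) : set R := `[a ord0 i, b ord0 i]%classic.
exists [set x : 'rV[R]_n | forall i, A i (x ord0 i)].
  by apply: (@rV_compact R n A) => i; exact: segment_compact.
by move=> x xab i; rewrite /A /= in_itv/=; have /andP[/ltW -> /ltW ->] := xab i.
Qed.

Lemma test_function_bump Omega m (a b : 'rV[R]_n) : 0 <= m ->
  closure (box a b) `<=` Omega -> test_function Omega (bump m a b).
Proof.
move=> m0 abO.
have sub : closure [set x | bump m a b x != 0] `<=` closure (box a b).
  apply: closure_subset => x /=; apply: contra_neqP => xab.
  by rewrite bump_notin.
split.
- by apply: smooth_tensor_bump_span => i; exact: bump_span_base.
- have [K cK abK] := box_sub_compact a b.
  have clK : closed K by exact: (compact_closed (@norm_hausdorff _ _) cK).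
  apply: (subclosed_compact _ cK); first exact: closed_closure.
  apply: (subset_trans sub); rewrite closureE; exact: smallest_sub.
- exact: subset_trans abO.
Qed.

Lemma bump_ge0 m (a b x : 'rV[R]_n) : 0 <= bump m a b x.
Proof. by apply: prodr_ge0 => i _; rewrite mul1r mulr_ge0// flat_ge0. Qed.

Lemma bump_le1 m (a b x : 'rV[R]_n) : bump m a b x <= 1.
Proof.
rewrite /bump /tensor -[leRHS](@big1_eq _ _ *%R 'I_n (index_enum 'I_n) predT).
apply: ler_prod => i _; rewrite mul1r mulr_ge0 ?flat_ge0//=.
by rewrite mulr_ile1 ?flat_ge0 ?flat0_le1.
Qed.

Lemma flat_scale_cvg (t : R) : 0 < t -> flat 0 (k.+1%:R * t) @[k --> \oo] --> (1 : R).
Proof.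
move=> t0; rewrite -[X in _ --> X](@expR0 R).
have -> : (fun k => flat 0 (k.+1%:R * t)) = expR \o (fun k => - (k.+1%:R^-1 * t^-1)).
  by apply/funext => k; rewrite /= flat_gt0 ?mulr_gt0// expr0 mul1r invfM.
apply: continuous_cvg; first exact: continuous_expR.
rewrite -[X in _ --> X]oppr0 -[X in - X](mul0r t^-1); apply: cvgN.
apply: cvgM; last exact: cvg_cst.
exact: cvg_harmonic.
Qed.

Lemma bump_cvg (a b x : 'rV[R]_n) :
  bump k.+1%:R a b x @[k --> \oo] --> (\1_(box a b) x : R).
Proof.
have [xab|xab] := pselect (box a b x); last first.
  rewrite indicE memNset//.
  under eq_fun do rewrite bump_notin//.
  exact: cvg_cst.
rewrite indicE mem_set// -[X in _ --> X](@big1_eq _ _ *%R 'I_n (index_enum 'I_n) predT).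
rewrite /bump /tensor; apply: cvg_big => [|i _]; first exact: mul_continuous.
have /andP[ax xb] := xab i.
have one : (1 * (1 * 1) : R) = 1 by rewrite !mulr1.
rewrite -[X in _ --> X]one; apply: cvgM; first exact: cvg_cst.
by apply: cvgM; apply: flat_scale_cvg; rewrite subr_gt0.
Qed.

End test_functions.

(** * The fundamental lemma of the calculus of variations *)

Section fundamental_lemma.
Context {R : realType} {n : nat}.
Local Notation mu := (lebesgue_rV n : {measure set 'rV[R]_n -> \bar R}).
Variable Omega : set 'rV[R]_n.
Hypothesis oOmega : open Omega.

Let mOmega : measurable Omega.
Proof. exact: open_measurable_rV. Qed.

(** Dominated convergence with majorant |f|, as bumps take values in [0, 1]. *)
Lemma integral_bump_cvg (f : 'rV[R]_n -> R) (a b : 'rV[R]_n) :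
  mu.-integrable Omega (EFin \o f) -> box a b `<=` Omega ->
  (\int[mu]_(x in Omega) (f x * bump k.+1%:R a b x)%:E)%E @[k --> \oo] -->
  (\int[mu]_(x in box a b) (f x)%:E)%E.
Proof.
move=> intf abO.
have mf : measurable_fun Omega f by apply/measurable_EFinP; exact: measurable_int intf.
have mfk k : measurable_fun Omega (EFin \o (fun x => f x * bump k.+1%:R a b x)).
  apply/measurable_EFinP/measurable_funM => //.
  apply: continuous_measurable_rV => //.
  have [] := @smooth_tensor_bump_span R n k.+1%:R a b _ (fun i => bump_span_base _ _ _ 1 0 0) [::].
  by [].
have mfl : measurable_fun Omega (EFin \o (fun x => f x * \1_(box a b) x)).
  apply/measurable_EFinP/measurable_funM => //.
  by apply: measurable_indic; exact: measurable_box.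
have cv : {ae mu, forall x, Omega x ->
    (EFin \o (fun x => f x * bump k.+1%:R a b x)) x @[k --> \oo] -->
    (EFin \o (fun x => f x * \1_(box a b) x)) x}.
  apply: aeW => x _; apply: cvg_EFin; first exact: nearW.
  by apply: cvgM; [exact: cvg_cst|exact: bump_cvg].
have ub : {ae mu, forall x k, Omega x ->
    (`|(EFin \o (fun x => f x * bump k.+1%:R a b x)%R) x| <= (abse \o (EFin \o f)) x)%E}.
  apply: aeW => x k _ /=; rewrite lee_fin normrM ler_piMr//.
  by rewrite ger0_norm ?bump_ge0// bump_le1.
have [_ _] := dominated_convergence mOmega mfk mfl cv (integrable_abse intf) ub.
rewrite (_ : \int[mu]_(x in box a b) (f x)%:E = \int[mu]_(x in Omega)
    (EFin \o (fun x => f x * \1_(box a b) x)%R) x)%E; first exact.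
rewrite -{1}(setIidr abO) integral_mkcondr; apply: eq_integral => x _.
rewrite patchE /= indicE.
by case: ifPn => xab; rewrite ?mulr1 ?mulr0.
Qed.

(** Bumps give equal integrals on boxes with closure in [Omega], Dynkin's lemma extends this to all
    measurable subsets of a rational ball, and countably many such balls cover [Omega]. *)
Lemma ae_eq_test_functions (f g : 'rV[R]_n -> R) :
  mu.-integrable Omega (EFin \o f) -> mu.-integrable Omega (EFin \o g) ->
  (forall phi, test_function Omega phi ->
    \int[mu]_(x in Omega) (f x * phi x)%:E = \int[mu]_(x in Omega) (g x * phi x)%:E)%E ->
  {ae mu, forall x, Omega x -> f x = g x}.
Proof.
move=> intf intg fg.
have boxE (a b : 'rV[R]_n) : closure (box a b) `<=` Omega ->
    (\int[mu]_(x in box a b) (f x)%:E = \int[mu]_(x in box a b) (g x)%:E)%E.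
  move=> abO.
  have abO' : box a b `<=` Omega by apply: subset_trans abO; exact: subset_closure.
  have cf := integral_bump_cvg intf abO'; have cg := integral_bump_cvg intg abO'.
  apply: (cvg_unique (@ereal_hausdorff R) cf); apply: cvg_trans cg; apply: near_eq_cvg.
  by apply: nearW => k; rewrite fg//; exact: test_function_bump.
(* Dynkin's lemma needs the whole space in the class, and [Omega] need not be a box. Working inside
   one ball [Q] settles this: [Q] is a box, and so is its intersection with any box, always with
   closure in [Omega]. *)
have QE (q : 'rV[rat]_n * rat) S : 0 < q.2 -> closure (rat_ball q : set 'rV[R]_n) `<=` Omega ->
    measurable S -> (\int[mu]_(x in rat_ball q `&` S) (f x)%:E =
       \int[mu]_(x in rat_ball q `&` S) (g x)%:E)%E.
  move=> q0 qO; rewrite rat_ball_box// in qO *.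
  set Q := box _ _ in qO *.
  have mQ : measurable Q by exact: measurable_box.
  have QO : Q `<=` Omega by apply: subset_trans qO; exact: subset_closure.
  have intfQ S' : measurable S' -> mu.-integrable (Q `&` S') (EFin \o f).
    move=> mS'; apply: integrableS intf => //; first exact: measurableI.
    by move=> x [/QO].
  have intgQ S' : measurable S' -> mu.-integrable (Q `&` S') (EFin \o g).
    move=> mS'; apply: integrableS intg => //; first exact: measurableI.
    by move=> x [/QO].
  rewrite measurable_boxesE.
  apply: (@dynkin_induction _ 'rV[R]_n (@boxes R n) (fun S =>
    (\int[mu]_(x in Q `&` S) (f x)%:E = \int[mu]_(x in Q `&` S) (g x)%:E)%E)).
  - exact: measurable_boxesE.
  - exact: setI_closed_boxes.
  - by rewrite setIT; exact: boxE.
  - move=> _ [a [b ->]]; rewrite boxI; apply: boxE; rewrite -boxI.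
    by apply: subset_trans qO; apply: closure_subset; exact: subIsetl.
  - move=> S0 mS0 IH.
    have split_int (h : 'rV[R]_n -> R) :
        (forall S', measurable S' -> mu.-integrable (Q `&` S') (EFin \o h)) ->
        (\int[mu]_(x in Q `&` ~` S0) (h x)%:E =
         \int[mu]_(x in Q) (h x)%:E - \int[mu]_(x in Q `&` S0) (h x)%:E)%E.
      move=> hh; apply/eqP; rewrite eq_sym sube_eq//; last 2 first.
      + by have := hh _ measurableT; rewrite setIT => /(integrable_fin_num mQ).
      + by apply: fin_num_adde_defl; apply: integrable_fin_num; [exact: measurableI|exact: hh].
      have QQ : (Q `&` ~` S0) `|` (Q `&` S0) = Q by rewrite -setIUr setvU setIT.
      rewrite -integral_setU ?QQ//.
      + by apply: measurableI => //; exact: measurableC.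
      + exact: measurableI.
      + by have /measurable_int := hh _ measurableT; rewrite setIT.
      + by rewrite disj_set2E -setIIr setICl setI0.
    by rewrite !split_int// IH boxE.
  - move=> F mF tF IH; rewrite setI_bigcupr.
    have tQ : trivIset setT (fun i => Q `&` F i).
      by apply: trivIset_setIl.
    have mQF k : measurable (Q `&` F k) by exact: measurableI.
    rewrite !integral_bigcup// -?setI_bigcupr; [|exact/intgQ/bigcupT_measurable|exact/intfQ/bigcupT_measurable].
    by apply: eq_eseriesr => i _; exact: IH.
have aeQ (q : 'rV[rat]_n * rat) : 0 < q.2 -> closure (rat_ball q : set 'rV[R]_n) `<=` Omega ->
    mu.-negligible (~` [set x | rat_ball q x -> f x = g x]).
  move=> q0 qO.
  have mQ : measurable (rat_ball q : set 'rV[R]_n) by rewrite rat_ball_box//; exact: measurable_box.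
  have QO : rat_ball q `<=` Omega by apply: subset_trans qO; exact: subset_closure.
  have /= H := @integral_ae_eq _ _ _ mu (rat_ball q) mQ (EFin \o g) (EFin \o f).
  have {H} : ae_eq mu (rat_ball q) (EFin \o f) (EFin \o g).
    apply: H; first exact: integrableS intf.
      by apply: measurable_int; exact: integrableS intg.
    by move=> E EQ mE; rewrite -(setIidr EQ); exact: QE.
  apply: negligibleS; apply: subsetC => x /= H xq.
  by have := H xq => -[].
(* The exceptional sets are numbered by codes of rational balls; a code of no admissible ball
   contributes the empty set. *)
pose N k := if (unpickle k : option ('rV[rat]_n * rat)) is Some q then
    if `[< 0 < q.2 /\ closure (rat_ball q : set 'rV[R]_n) `<=` Omega >] then
      ~` [set x : 'rV[R]_n | rat_ball q x -> f x = g x] else set0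
  else set0.
have : mu.-negligible (\bigcup_k N k).
  apply: negligible_bigcup => k; rewrite /N.
  case: unpickle => [q|]; last exact: negligible_set0.
  by case: asboolP => [[q0 qO]|_]; [exact: aeQ|exact: negligible_set0].
apply: negligibleS => x /= /not_implyP[Ox fgx].
have [q [q0 xq qO]] := open_rat_ball oOmega Ox.
exists (pickle q) => //; rewrite /N pickleK asboolT//= => /(_ xq).
by [].
Qed.

End fundamental_lemma.

(** * Test functions and integration by parts *)

Section test_function_theory.
Context {R : realType} {n : nat}.
Local Notation mu := (lebesgue_rV n : {measure set 'rV[R]_n -> \bar R}).
Variables (Omega : set 'rV[R]_n) (phi : 'rV[R]_n -> R).
Hypothesis tphi : test_function Omega phi.

Let K := closure [set x | phi x != 0].

Lemma test_function_notin x : ~ K x -> phi x = 0.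
Proof. by move=> Kx; apply/eqP/negPn/negP => px; apply: Kx; exact: subset_closure. Qed.

Lemma partial_test_function_notin j x : ~ K x -> partial j phi x = 0.
Proof.
move=> Kx; rewrite /partial.
have H : \near x, phi x = cst 0 x.
  have oK : open (~` K) by apply: closed_openC; exact: closed_closure.
  near=> y; apply: test_function_notin.
  by near: y; apply: open_nbhs_nbhs.
by rewrite (near_eq_derive _ H) derive_cst.
Unshelve. all: by end_near. Qed.

Lemma continuous_compact_support_bounded (f : 'rV[R]_n -> R) (A : set 'rV[R]_n) :
  continuous f -> compact A -> (forall x, ~ A x -> f x = 0) ->
  exists M, forall x, `|f x| <= M.
Proof.
move=> cf cA f0.
have : compact (f @` A).
  by apply: continuous_compact => //; exact: continuous_subspaceT.
move=> /compact_bounded[M [_ HM]]; exists (`|M| + 1) => x.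
have [xA|xA] := pselect (A x); last by rewrite f0// normr0 addr_ge0.
apply: HM; last by exists x.
by rewrite (le_lt_trans (ler_norm _))// ltrDl.
Qed.

Lemma test_function_continuous : continuous phi.
Proof. by have [/(_ [::])[]] := tphi. Qed.

Lemma test_function_derivable j x : derivable phi x (delta_mx ord0 j).
Proof. by have [/(_ [::])[_]] := tphi. Qed.

Lemma partial_test_function_continuous j : continuous (partial j phi).
Proof. by have [/(_ [:: j])[]] := tphi. Qed.

(** The product [v * phi] vanishes off a compact subset of [Omega], so its partial derivative has
    integral 0 over R^n, and no regularity of the boundary enters. *)
Lemma weak_derivative_classical (v : 'rV[R]_n -> R) (j : 'I_n) (M M' : R) :
  measurable Omega -> continuous v -> continuous (partial j v) ->
  (forall x, derivable v x (delta_mx ord0 j)) ->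
  (forall x, `|v x| <= M) -> (forall x, `|partial j v x| <= M') ->
  (\int[mu]_(x in Omega) (v x * partial j phi x)%:E =
   - \int[mu]_(x in Omega) (partial j v x * phi x)%:E)%E.
Proof.
move=> mO cv cdv dv vM dvM'.
have [_ cK KO] := tphi.
have phi0 := test_function_notin; have dphi0 := partial_test_function_notin j.
have [B phiB] := continuous_compact_support_bounded test_function_continuous cK phi0.
have [B' phiB'] := continuous_compact_support_bounded
  (@partial_test_function_continuous j) cK dphi0.
have [r r0 Kr] := bounded_set_cube (compact_bounded cK).
have m1 : measurable_fun setT (fun x => v x * partial j phi x).
  by apply: measurable_funM; apply: continuous_measurable_rV => //; exact: partial_test_function_continuous.
have m2 : measurable_fun setT (fun x => partial j v x * phi x).
  by apply: measurable_funM; apply: continuous_measurable_rV => //; exact: test_function_continuous.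
have s1 x : ~ K x -> v x * partial j phi x = 0 by move=> /dphi0 ->; rewrite mulr0.
have s2 x : ~ K x -> partial j v x * phi x = 0 by move=> /phi0 ->; rewrite mulr0.
have b1 x : `|v x * partial j phi x| <= M * B' by rewrite normrM ler_pM.
have b2 x : `|partial j v x * phi x| <= M' * B by rewrite normrM ler_pM.
have i1 : mu.-integrable setT (EFin \o (fun x => v x * partial j phi x)).
  by apply: (@integrable_cube _ _ _ r _ m1 b1) => x xr; apply: s1 => /Kr.
have i2 : mu.-integrable setT (EFin \o (fun x => partial j v x * phi x)).
  by apply: (@integrable_cube _ _ _ r _ m2 b2) => x xr; apply: s2 => /Kr.
(* Both integrands vanish off [K], which lies in [Omega], so the domain of integration may be
   enlarged to the whole space. *)
have toT (f : 'rV[R]_n -> R) : (forall x, ~ K x -> f x = 0) ->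
    (\int[mu]_(x in Omega) (f x)%:E = \int[mu]_x (f x)%:E)%E.
  move=> f0; rewrite integral_mkcond; apply: eq_integral => x _; rewrite patchE.
  by case: ifPn => //; rewrite notin_setE => xO; rewrite f0// => /KO.
rewrite !toT//.
have dw x : partial j (v * phi) x = v x * partial j phi x + partial j v x * phi x.
  rewrite /partial deriveM//; last exact: test_function_derivable.
  by rewrite -!/(partial _ _ _) /GRing.scale/= [X in _ + X]mulrC.
have mw : measurable_fun setT (v * phi).
  by apply: measurable_funM; apply: continuous_measurable_rV => //; exact: test_function_continuous.
have : (\int[mu]_x (partial j (v * phi) x)%:E = 0)%E.
  apply: (@integral_partial_eq0 _ _ _ _ (M * B) (M * B' + M' * B) r) => //.
  - by move=> x; apply: derivableM => //; exact: test_function_derivable.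
  - by move=> x; rewrite /= normrM ler_pM.
  - by move=> x; rewrite dw (le_trans (ler_normD _ _))// lerD.
  - by move=> x xr; rewrite fctE phi0 ?mulr0// => /Kr.
under eq_integral do rewrite dw EFinD.
rewrite (integralD_EFin measurableT i1 i2) => H.
by rewrite -[LHS](addeK _ (integrable_fin_num measurableT i2)) H add0e.
Qed.

End test_function_theory.

(** * Approximation by functions with gradient concentrated on thin layers *)

Section ramp.
Context {R : realType}.

Definition pos_part (t : R) : R := Num.max t 0.

Lemma pos_partP (t : R) :
  (t <= 0 /\ pos_part t = 0) \/ (0 <= t /\ pos_part t = t).
Proof.
rewrite /pos_part; case: (leP t 0) => t0; first by left; split.
by right; split => //; exact: ltW.
Qed.

(** Squaring removes the kink at 0: the difference quotient there is [pos_part] itself, which is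
    squeezed between 0 and |h|. *)
Lemma is_derive_sqr_pos_part (t : R) :
  is_derive t (1:R) (fun t => pos_part t ^+ 2) (2 * pos_part t).
Proof.
have [t0|t0|->] := ltrgtP t 0.
- have -> : 2 * pos_part t = 0 by rewrite /pos_part max_r ?mulr0// ltW.
  have H : \near t, cst (0:R) t = pos_part t ^+ 2.
    near=> y; rewrite /pos_part max_r ?expr0n//; apply/ltW; near: y.
    by apply: open_nbhs_nbhs; split => //; exact: open_lt.
  by apply: (near_eq_is_derive H).
- have -> : 2 * pos_part t = 2 * t by rewrite /pos_part max_l// ltW.
  have H : \near t, ((id : R -> R) ^+ 2) t = pos_part t ^+ 2.
    near=> y; rewrite /pos_part max_l ?exprfctE//; apply/ltW; near: y.
    by apply: open_nbhs_nbhs; split => //; exact: open_gt.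
  apply: (near_eq_is_derive H).
  have := is_deriveX 2 (is_derive_id t (1:R)).
  by rewrite /= expr1 [_ *: 1]mulr1.
- have p0 : pos_part 0 = 0 by rewrite /pos_part maxxx.
  rewrite p0 mulr0.
  have lim0 : (h^-1 *: (((fun t => pos_part t ^+ 2) \o shift (0:R)) (h *: 1) - pos_part 0 ^+ 2))
      @[h --> 0^'] --> (0 : R).
    apply: (@cvg_trans _ (pos_part @ 0^')).
      apply: near_eq_cvg; near=> h; rewrite /= p0 expr0n subr0 addr0 [h *: 1]mulr1.
      have h0 : h != 0 by near: h; exact: nbhs_dnbhs_neq.
      have [[_ ->]|[_ ->]] := pos_partP h; first by rewrite expr0n scaler0.
      by rewrite expr2 [_ *: _]mulrA mulVf ?mul1r.
    apply: cvg_within_filter.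
    apply: (@squeeze_cvgr _ _ _ _ (fun=> 0) (fun h => `|h|)).
    + near=> h; have [[_ ->]|[h0 ->]] := pos_partP h; first by rewrite lexx normr_ge0.
      by rewrite h0 ler_norm.
    + exact: cvg_cst.
    + by rewrite -[X in _ --> X](@normr0 R R); apply: cvg_norm; exact: cvg_id.
  apply: DeriveDef; first by apply/cvg_ex; exists 0.
  exact: cvg_lim lim0.
Unshelve. all: by end_near. Qed.

(* A C^1 ramp from 0 to 1 on [0, 1]: its derivative is the tent of height 2. *)
Definition ramp (t : R) : R :=
  2 * pos_part t ^+ 2 - 4 * pos_part (t - 2^-1) ^+ 2 + 2 * pos_part (t - 1) ^+ 2.

Definition dramp (t : R) : R :=
  4 * pos_part t - 8 * pos_part (t - 2^-1) + 4 * pos_part (t - 1).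

Lemma is_derive_ramp (t : R) : is_derive t (1:R) ramp (dramp t).
Proof.
have sh (c : R) : is_derive t (1:R) (fun t => pos_part (t - c) ^+ 2) (2 * pos_part (t - c)).
  rewrite -[X in is_derive _ _ _ X]mulr1.
  apply: (@is_derive1_comp _ (fun t => pos_part t ^+ 2) (fun t => t - c)).
    exact: is_derive_sqr_pos_part.
  exact: (is_derive_shift t 1 (- c)).
have H := is_deriveD (is_deriveD (is_deriveZ 2 (is_derive_sqr_pos_part t))
  (is_deriveZ (- 4) (sh 2^-1))) (is_deriveZ 2 (sh 1)).
have -> : ramp = (2 *: (fun t => pos_part t ^+ 2) + - 4 *: (fun t => pos_part (t - 2^-1) ^+ 2)
   + 2 *: (fun t => pos_part (t - 1) ^+ 2))%R.
  by apply/funext => x; rewrite /ramp !fctE /GRing.scale/= mulNr.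
by apply: is_derive_eq H _; rewrite /dramp /GRing.scale/=; ring.
Qed.

(** Turns the ramp and its derivative into polynomials in three positive parts, so that each sign
    pattern is left to real arithmetic. *)
Ltac case_pos_parts t := rewrite /ramp /dramp;
  have := pos_partP t; have := pos_partP (t - 2^-1); have := pos_partP (t - 1);
  move: (pos_part t) (pos_part (t - 2^-1)) (pos_part (t - 1)) => p q r.

Lemma ramp_le0 t : t <= 0 -> ramp t = 0.
Proof.
case_pos_parts t => [] [[? ->]|[? ->]] [[? ->]|[? ->]] [[? ->]|[? ->]] ?; nra.
Qed.

Lemma ramp_ge1 t : 1 <= t -> ramp t = 1.
Proof.
case_pos_parts t => [] [[? ->]|[? ->]] [[? ->]|[? ->]] [[? ->]|[? ->]] ?; nra.
Qed.

Lemma ramp_itv t : 0 <= ramp t <= 1.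
Proof.
case_pos_parts t => [] [[? ->]|[? ->]] [[? ->]|[? ->]] [[? ->]|[? ->]];
  apply/andP; split; nra.
Qed.

Lemma normr_dramp_le t : `|dramp t| <= 2.
Proof.
rewrite ler_norml.
case_pos_parts t => [] [[? ->]|[? ->]] [[? ->]|[? ->]] [[? ->]|[? ->]];
  apply/andP; split; lra.
Qed.

Lemma dramp_out t : t <= 0 \/ 1 <= t -> dramp t = 0.
Proof.
case_pos_parts t => [] [[? ->]|[? ->]] [[? ->]|[? ->]] [[? ->]|[? ->]] []?; lra.
Qed.

Lemma continuous_pos_part : continuous pos_part.
Proof. by move=> t; apply: continuous_max; [exact: cvg_id|exact: cvg_cst]. Qed.

Lemma continuous_dramp : continuous dramp.
Proof.
have c (k a : R) : continuous (fun t => k * pos_part (t - a)).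
  move=> t; apply: cvgM; first exact: cvg_cst.
  apply: (@continuous_comp _ _ _ (fun t => t - a)); last exact: continuous_pos_part.
  by apply: cvgB; [exact: cvg_id|exact: cvg_cst].
move=> t; apply: cvgD; last exact: c.
apply: cvgB; last exact: c.
apply: cvgM; first exact: cvg_cst.
exact: continuous_pos_part.
Qed.

Lemma continuous_ramp : continuous ramp.
Proof.
move=> t; apply: differentiable_continuous; apply/derivable1_diffP.
by have [] := is_derive_ramp t.
Qed.

Variables (a b d : R).
Hypothesis d0 : 0 < d.

(** A product of a rising and a falling ramp, rather than a definition by cases, stays meaningful
    when the interval is shorter than 2d and the two ramps overlap. *)
Definition plateau (t : R) : R := ramp (d^-1 * (t - a)) * ramp (d^-1 * (b - t)).

Definition dplateau (t : R) : R :=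
  d^-1 * (dramp (d^-1 * (t - a)) * ramp (d^-1 * (b - t))
          - ramp (d^-1 * (t - a)) * dramp (d^-1 * (b - t))).

Lemma is_derive_plateau t : is_derive t (1:R) plateau (dplateau t).
Proof.
have d1 : is_derive t (1:R) (fun t => ramp (d^-1 * (t - a))) (dramp (d^-1 * (t - a)) * d^-1).
  apply: (@is_derive1_comp _ ramp (fun t => d^-1 * (t - a))); first exact: is_derive_ramp.
  exact: is_derive_affine.
have d2 : is_derive t (1:R) (fun t => ramp (d^-1 * (b - t))) (dramp (d^-1 * (b - t)) * - d^-1).
  apply: (@is_derive1_comp _ ramp (fun t => d^-1 * (b - t))); first exact: is_derive_ramp.
  have := is_derive_affine (- d^-1) b t; congr is_derive.
  by apply/funext => y; rewrite mulNr -mulrN opprB.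
by apply: is_derive_eq (is_deriveM d1 d2) _; rewrite /dplateau /GRing.scale/=; ring.
Qed.

Lemma continuous_scaled (f : R -> R) (m c : R) : continuous f ->
  continuous (fun t => f (m * (t - c))).
Proof.
move=> cf t; apply: (@continuous_comp _ _ _ (fun t => m * (t - c))); last exact: cf.
by apply: cvgM; [exact: cvg_cst|apply: cvgB; [exact: cvg_id|exact: cvg_cst]].
Qed.

Lemma continuous_scaledN (f : R -> R) (m c : R) : continuous f ->
  continuous (fun t => f (m * (c - t))).
Proof.
move=> cf t; apply: (@continuous_comp _ _ _ (fun t => m * (c - t))); last exact: cf.
by apply: cvgM; [exact: cvg_cst|apply: cvgB; [exact: cvg_cst|exact: cvg_id]].
Qed.

Lemma continuous_plateau : continuous plateau.
Proof.
move=> t; apply: cvgM.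
  by apply: continuous_scaled; exact: continuous_ramp.
by apply: continuous_scaledN; exact: continuous_ramp.
Qed.

Lemma continuous_dplateau : continuous dplateau.
Proof.
move=> t; apply: cvgM; first exact: cvg_cst.
apply: cvgB; apply: cvgM;
  (apply: continuous_scaled || apply: continuous_scaledN);
  (exact: continuous_ramp || exact: continuous_dramp).
Qed.

Lemma plateau_itv t : 0 <= plateau t <= 1.
Proof.
have /andP[p0 p1] := ramp_itv (d^-1 * (t - a)).
have /andP[q0 q1] := ramp_itv (d^-1 * (b - t)).
by rewrite /plateau mulr_ge0// mulr_ile1.
Qed.

(** Each of the two ramps has slope at most 2 before scaling and is multiplied by a factor in
    [0, 1]: hence 2 + 2. *)
Lemma normr_dplateau_le t : `|dplateau t| <= 4 / d.
Proof.
have /andP[p0 p1] := ramp_itv (d^-1 * (t - a)).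
have /andP[q0 q1] := ramp_itv (d^-1 * (b - t)).
have := normr_dramp_le (d^-1 * (t - a)); have := normr_dramp_le (d^-1 * (b - t)).
rewrite /dplateau normrM gtr0_norm ?invr_gt0// [4 / d]mulrC ler_pM2l ?invr_gt0//.
move: p0 p1 q0 q1; move: (ramp _) (ramp _) (dramp _) (dramp _) => p q p' q'.
rewrite !ler_norml => ? ? ? ? /andP[? ?] /andP[? ?]; apply/andP; split; nra.
Qed.

Definition layer : set R := `[a, a + d]%classic `|` `[b - d, b]%classic.

Lemma layer_out t : ~ layer t ->
  (t < a \/ a + d < t) /\ (t < b - d \/ b < t).
Proof.
move=> /not_orP[]; rewrite /= !in_itv/= => /negP + /negP.
by rewrite !negb_and -!ltNge => /orP + /orP.
Qed.

Lemma scaled_le0 x : x <= 0 -> d^-1 * x <= 0.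
Proof. by move=> x0; rewrite mulr_ge0_le0// invr_ge0 ltW. Qed.

Lemma scaled_ge1 x : d <= x -> 1 <= d^-1 * x.
Proof. by move=> x0; rewrite mulrC ler_pdivlMr// mul1r. Qed.

Lemma dplateau_out t : ~ layer t -> dplateau t = 0.
Proof.
move=> /layer_out[ta tb]; rewrite /dplateau.
have -> : dramp (d^-1 * (t - a)) = 0.
  apply: dramp_out; case: ta => ta; [left; apply: scaled_le0|right; apply: scaled_ge1]; lra.
have -> : dramp (d^-1 * (b - t)) = 0.
  by apply: dramp_out; case: tb => tb; [right; apply: scaled_ge1|left; apply: scaled_le0]; lra.
by ring.
Qed.

Lemma plateau_notin t : ~ (a < t < b) -> plateau t = 0.
Proof.
move=> tab; rewrite /plateau.
have [at_|ta] := ltP a t; last by rewrite ramp_le0 ?mul0r//; apply: scaled_le0; lra.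
have [tb|bt] := ltP t b; first by exfalso; apply: tab; rewrite at_ tb.
by rewrite [ramp (_ * (b - t))]ramp_le0 ?mulr0//; apply: scaled_le0; lra.
Qed.

Lemma plateau_in t : a < t < b -> ~ layer t -> plateau t = 1.
Proof.
move=> /andP[at_ tb] /layer_out[ta bt]; rewrite /plateau.
rewrite !ramp_ge1 ?mulr1//; apply: scaled_ge1.
  by case: bt; lra.
by case: ta; lra.
Qed.

End ramp.

(** * Stability of layer approximation under linear combinations and L^1 limits *)

Section recoverable.
Context {R : realType} {n : nat}.
Local Notation mu := (lebesgue_rV n : {measure set 'rV[R]_n -> \bar R}).
Variable Omega : set 'rV[R]_n.
Hypothesis oOmega : open Omega.
Hypothesis bOmega : bounded_set Omega.

Let mOmega : measurable Omega.
Proof. exact: open_measurable_rV. Qed.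

Let Omega_lty : (mu Omega < +oo)%E.
Proof. exact: bounded_set_lty. Qed.

(** Only the bound on the gradient is a parameter, since it enters the energy; a bound on [w] merely
    has to exist, for integrability. *)
Record C1_bounded (w : 'rV[R]_n -> R) (K : R) : Prop := {
  C1_continuous : continuous w;
  C1_derivable : forall j x, derivable w x (delta_mx ord0 j);
  C1_partial : forall j, continuous (partial j w);
  C1_ub : exists M, forall x, `|w x| <= M;
  C1_partial_ub : forall j x, `|partial j w x| <= K }.

Lemma C1_boundedD w1 w2 K1 K2 : C1_bounded w1 K1 -> C1_bounded w2 K2 ->
  [/\ C1_bounded (w1 \+ w2) (K1 + K2) &
      forall j x, partial j (w1 \+ w2) x = partial j w1 x + partial j w2 x].
Proof.
move=> [c1 d1 p1 [M1 u1] q1] [c2 d2 p2 [M2 u2] q2].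
have pE j x : partial j (w1 \+ w2) x = partial j w1 x + partial j w2 x.
  by rewrite /partial [LHS]deriveD.
split => //; split.
- by move=> x; exact: (continuousD (c1 x) (c2 x)).
- by move=> j x; exact: derivableD.
- move=> j; have -> : partial j (w1 \+ w2) = partial j w1 \+ partial j w2 by apply/funext.
  by move=> x; exact: (continuousD (p1 j x) (p2 j x)).
- by exists (M1 + M2) => x; rewrite (le_trans (ler_normD _ _))// lerD.
- by move=> j x; rewrite pE (le_trans (ler_normD _ _))// lerD.
Qed.

Lemma C1_boundedZ (c : R) w K : C1_bounded w K ->
  C1_bounded (c \*: w) (`|c| * K) /\
  forall j x, partial j (c \*: w) x = c * partial j w x.
Proof.
move=> [cw dw p [M u] q].
have pE j x : partial j (c \*: w) x = c * partial j w x.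
  by rewrite /partial [LHS]deriveZ.
split => //; split.
- by move=> x; exact: (continuousM (@cst_continuous _ _ c x) (cw x)).
- by move=> j x; exact: derivableZ.
- move=> j; have -> : partial j (c \*: w) = (fun x => c * partial j w x) by apply/funext.
  by move=> x; exact: (continuousM (@cst_continuous _ _ c x) (p j x)).
- by exists (`|c| * M) => x; rewrite /GRing.scale/= normrM ler_wpM2l.
- by move=> j x; rewrite pE normrM ler_wpM2l.
Qed.

Local Notation int v := (mu.-integrable Omega (EFin \o v)).
Local Notation dist v w := (\int[mu]_(x in Omega) (`|v x - w x|%:E))%E.

Lemma C1_measurable w K : C1_bounded w K -> measurable_fun Omega w.
Proof. by case=> cw _ _ _ _; exact: continuous_measurable_rV. Qed.

Lemma bounded_int (w : 'rV[R]_n -> R) M : measurable_fun Omega w ->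
  (forall x, `|w x| <= M) -> int w.
Proof.
move=> mw wM; apply: measurable_bounded_integrable => //.
exists M; split; first exact: num_real.
by move=> y My x _ /=; exact: le_trans (wM x) (ltW My).
Qed.

Lemma C1_int w K : C1_bounded w K -> int w.
Proof. by move=> cw; have [_ _ _ [M wM] _] := cw; apply: bounded_int wM; exact: C1_measurable cw. Qed.

Lemma dist_int v w : int v -> int w -> int (fun x => `|v x - w x|).
Proof.
move=> iv iw; apply: integrable_norm => //.
by have := integrableB mOmega iv iw; apply: eq_integrable => // x _.
Qed.

Lemma dist_trans v w z : int v -> int w -> int z ->
  (dist v z <= dist v w + dist w z)%E.
Proof.
move=> iv iw iz.
rewrite -(integralD_EFin mOmega (dist_int iv iw) (dist_int iw iz)).
apply: ge0_le_integral => //.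
- by apply: measurable_int; exact: dist_int.
- by apply: emeasurable_funD; apply: measurable_int; exact: dist_int.
- by move=> x _ /=; rewrite -EFinD lee_fin -[v x - z x](subrKA (w x)) ler_normD.
Qed.

(* [v] is an L^1 limit, up to an error [tau], of functions whose gradient is
   of order [1 / d] and vanishes off a set of measure of order [d]. *)
Definition recoverable (v : 'rV[R]_n -> R) : Prop :=
  int v /\ forall tau, 0 < tau -> exists2 C, 0 <= C & forall d, 0 < d < 1 ->
    exists w L, [/\ C1_bounded w (C / d),
      (forall j x, Omega x -> ~ L x -> partial j w x = 0),
      measurable L, (mu (L `&` Omega) <= (C * d)%:E)%E
      & (dist w v <= (tau + C * d)%:E)%E].

(** Layers are united, constants added, and each summand is granted half of the tolerance. *)
Lemma recoverableD v1 v2 : recoverable v1 -> recoverable v2 ->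
  recoverable (v1 \+ v2).
Proof.
move=> [i1 r1] [i2 r2].
have i12 : int (v1 \+ v2) by have := integrableD mOmega i1 i2.
split => // tau tau0.
have [C1 C10 H1] := r1 (tau / 2) (divr_gt0 tau0 (ltr0n _ 2)).
have [C2 C20 H2] := r2 (tau / 2) (divr_gt0 tau0 (ltr0n _ 2)).
exists (C1 + C2); first exact: addr_ge0.
move=> d d01; have [w1 [L1 [b1 z1 m1 s1 t1]]] := H1 _ d01.
have [w2 [L2 [b2 z2 m2 s2 t2]]] := H2 _ d01.
have [bD pD] := C1_boundedD b1 b2.
exists (w1 \+ w2), (L1 `|` L2); split.
- by rewrite mulrDl.
- by move=> j x Ox /not_orP[x1 x2]; rewrite pD z1// z2// addr0.
- exact: measurableU.
- rewrite setIUl mulrDl EFinD.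
  by apply: le_trans (measureU2 _ _ _) _; [exact: measurableI|exact: measurableI|exact: leeD].
- have j1 := C1_int b1; have j2 := C1_int b2.
  have -> : (tau + (C1 + C2) * d)%:E = ((tau / 2 + C1 * d)%:E + (tau / 2 + C2 * d)%:E)%E.
    by rewrite -EFinD; congr EFin; field.
  apply: le_trans (leeD t1 t2).
  rewrite -(integralD_EFin mOmega (dist_int j1 i1) (dist_int j2 i2)).
  apply: ge0_le_integral => //.
  + by apply: measurable_int; apply: dist_int => //; exact: C1_int bD.
  + by apply: emeasurable_funD; apply: measurable_int; exact: dist_int.
  + by move=> x _ /=; rewrite -EFinD lee_fin opprD addrACA ler_normD.
Qed.

Lemma recoverableZ (c : R) v : recoverable v -> recoverable (c \*: v).
Proof.
move=> [iv rv].
have icv : int (c \*: v) by have := integrableZl mOmega c iv.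
split => // tau tau0.
(* Using |c| + 1 in place of |c| allows the tolerance to be divided by it even when [c] is 0. *)
have c10 : 0 < `|c| + 1 by rewrite ltr_wpDl.
have [C C0 H] := rv (tau / (`|c| + 1)) (divr_gt0 tau0 c10).
exists ((`|c| + 1) * C); first by rewrite mulr_ge0// ltW.
move=> d d01; have [w [L [b z m s t]]] := H _ d01; have /andP[d0 _] := d01.
have [bZ pZ] := C1_boundedZ c b.
have ? : `|c| * C <= (`|c| + 1) * C by rewrite ler_wpM2r// lerDl.
exists (c \*: w), L; split => //.
- case: bZ => ? ? ? ? q; split => // j x; rewrite (le_trans (q j x))//.
  by rewrite mulrA ler_wpM2r// invr_ge0 ltW.
- by move=> j x Ox Lx; rewrite pZ z// mulr0.
- apply: le_trans s _; rewrite lee_fin ler_wpM2r ?(ltW d0)//.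
  by rewrite ler_peMl// lerDr.
- rewrite -[X in (_ <= X%:E)%E](_ : (`|c| + 1) * (tau / (`|c| + 1) + C * d) = _); last first.
    by field; rewrite gt_eqF.
  have iw := C1_int b.
  have -> : dist (c \*: w) (c \*: v) = (`|c|%:E * dist w v)%E.
    rewrite -integralZl//; last exact: dist_int.
    by apply: eq_integral => x _; rewrite /= -EFinM -normrM mulrBr.
  rewrite EFinM lee_pmul//; first by apply: integral_ge0.
  by rewrite lee_fin lerDl.
Qed.

(** The approximant [v'] is chosen before [d], so its constant serves for all widths; the distance
    from [v'] to [v] is absorbed by the part [tau] of the error, which does not shrink with [d]. *)
Lemma recoverable_closed v : int v ->
  (forall tau, 0 < tau -> exists2 v', recoverable v' & (dist v' v <= tau%:E)%E) ->
  recoverable v.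
Proof.
move=> iv H; split => // tau tau0.
have tau20 : 0 < tau / 2 by rewrite divr_gt0.
have [v' [iv' rv'] v'v] := H _ tau20; have [C C0 rC] := rv' _ tau20.
exists C => // d d01; have [w [L [b z m s t]]] := rC _ d01.
exists w, L; split => //.
apply: le_trans (dist_trans (C1_int b) iv' iv) _.
have -> : tau + C * d = (tau / 2 + C * d) + tau / 2 by field.
by rewrite EFinD; apply: leeD.
Qed.

End recoverable.

Lemma cvg0_near_lt {R : realType} {T : Type} (F : set_system T) (f : T -> \bar R) (tau : R) :
  f @ F --> 0%E -> 0 < tau -> \forall x \near F, (f x < tau%:E)%E.
Proof.
move=> cf tau0; have t0 : (0 < tau%:E)%E by rewrite lte_fin.
exact: cf _ (open_ereal_lt' t0).
Qed.

(** * Layer approximation of boxes, Borel sets and integrable functions *)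

Section recoverable_integrable.
Context {R : realType} {n : nat}.
Local Notation mu := (lebesgue_rV n : {measure set 'rV[R]_n -> \bar R}).
Variable Omega : set 'rV[R]_n.
Hypothesis oOmega : open Omega.
Hypothesis bOmega : bounded_set Omega.

Let mOmega : measurable Omega.
Proof. exact: open_measurable_rV. Qed.

Local Notation int v := (mu.-integrable Omega (EFin \o v)).
Local Notation dist v w := (\int[mu]_(x in Omega) (`|v x - w x|%:E))%E.

Definition slab (j : 'I_n) (c1 c2 : R) : set 'rV[R]_n :=
  rV_coord j @^-1` `[c1, c2]%classic.

Lemma measurable_slab j c1 c2 : measurable (slab j c1 c2).
Proof. by rewrite -[X in measurable X]setTI; apply: measurable_rV_coord. Qed.

Lemma measure_slab : exists2 C, 0 <= C & forall (j : 'I_n) (c d : R), 0 < d ->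
  (mu (slab j c (c + d)%R `&` Omega) <= (C * d)%:E)%E.
Proof.
have [r r0 Or] := bounded_set_cube bOmega.
have r20 : 0 <= 2 * r by rewrite mulr_ge0// ltW.
(* In a cube of half-side [r] a slab of width [d] has measure at most d (2r)^(n-1); summing this
   factor over [j] gives one constant for all directions. *)
exists (\sum_(j < n) \prod_(i < n | i != j) (2 * r)).
  by apply: sumr_ge0 => j _; apply: prodr_ge0.
move=> j c d d0.
pose A (i : 'I_n) : set R := if i == j then `[c, (c + d)%R]%classic else `](- r), r[%classic.
have mA i : measurable (A i) by rewrite /A; case: ifP => _; exact: measurable_itv.
have lA : (mu [set x | forall i, A i (x ord0 i)] =
    (d * \prod_(i < n | i != j) (2 * r))%:E)%E.
  rewrite [LHS](lebesgue_rV_prod mA) (bigD1 j)//= EFinM; congr (_ * _)%E.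
    rewrite /A eqxx lebesgue_measure_itv/= lte_fin ltrDl d0.
    by rewrite -EFinB addrC addKr.
  rewrite -prodEFin; apply: eq_bigr => i ij; rewrite /A (negbTE ij).
  rewrite lebesgue_measure_itv/= lte_fin gtrN// -EFinB; congr EFin; ring.
apply: (@le_trans _ _ (mu [set x | forall i, A i (x ord0 i)])).
  apply: le_measure; rewrite ?inE.
  - by apply: measurableI => //; exact: measurable_slab.
  - exact: measurable_coordinatewise.
  - move=> x [xj /Or xr] i; rewrite /A; case: eqP => [->//|_].
    by have := xr i; rewrite !mxE /= in_itv.
rewrite lA lee_fin mulrC ler_wpM2r ?(ltW d0)//.
by rewrite [leRHS](bigD1 j)//= lerDl; apply: sumr_ge0 => k _; apply: prodr_ge0.
Qed.

(** A partial derivative has one factor bounded by [K] and the others in [0, 1], so the product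
    inherits the bound [K]. *)
Lemma C1_bounded_tensor (f df : 'I_n -> R -> R) (K : R) : 0 <= K ->
  (forall i, continuous (f i)) -> (forall i, continuous (df i)) ->
  (forall i t, is_derive t (1:R) (f i) (df i t)) ->
  (forall i t, 0 <= f i t <= 1) -> (forall i t, `|df i t| <= K) ->
  C1_bounded (tensor f) K /\
  forall j x, partial j (tensor f) x = tensor (subst_factor f j (df j)) x.
Proof.
move=> K0 cf cdf dfP f01 dfK.
have pE j x : partial j (tensor f) x = tensor (subst_factor f j (df j)) x.
  by have [_] := @is_derive_tensor _ _ f j (df j) x (dfP j (x ord0 j)).
split => //; split.
- exact: continuous_tensor.
- by move=> j x; have [] := @is_derive_tensor _ _ f j (df j) x (dfP j (x ord0 j)).
- move=> j; have -> : partial j (tensor f) = tensor (subst_factor f j (df j)) by apply/funext.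
  by apply: continuous_tensor => i; rewrite /subst_factor; case: eqP.
- exists 1 => x; rewrite /tensor normr_prod.
  rewrite -[leRHS](@big1_eq _ _ *%R 'I_n (index_enum 'I_n) predT).
  by apply: ler_prod => i _; have /andP[? ?] := f01 i (x ord0 i); rewrite normr_ge0 ger0_norm.
- move=> j x; rewrite pE /tensor normr_prod (bigD1 j)//= /subst_factor eqxx.
  rewrite -[leRHS]mulr1 ler_pM//; first by apply: prodr_ge0.
  rewrite -[leRHS](@big1_eq _ _ *%R 'I_n (index_enum 'I_n) (fun i => i != j)).
  apply: ler_prod => i /negbTE ->; have /andP[? ?] := f01 i (x ord0 i).
  by rewrite normr_ge0 ger0_norm.
Qed.

Lemma indic_int (B : set 'rV[R]_n) : measurable B -> int (\1_B).
Proof.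
move=> mB; apply: (@bounded_int _ _ _ oOmega bOmega _ 1).
  exact: measurable_indic.
by move=> x; rewrite indicE; case: (_ \in _); rewrite ?normr1 ?normr0.
Qed.

(** The product of plateaus equals the indicator off the layers, so the L^1 error is at most the
    measure of the layers. *)
Lemma recoverable_box (a b : 'rV[R]_n) : recoverable Omega (\1_(box a b)).
Proof.
split; first by apply: indic_int; exact: measurable_box.
have [C C0 slabC] := measure_slab.
(* One constant for two bounds: 4 for the slope of a plateau, and two slabs, one per face, in each
   direction for the measure. *)
move=> tau tau0; exists (4 + \sum_(j < n) (C + C)).
  by rewrite addr_ge0// sumr_ge0// => j _; exact: addr_ge0.
have S0 : 0 <= \sum_(j < n) (C + C) by rewrite sumr_ge0// => j _; exact: addr_ge0.
move=> d /andP[d0 _].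
pose f (i : 'I_n) := plateau (a ord0 i) (b ord0 i) d.
pose df (i : 'I_n) := dplateau (a ord0 i) (b ord0 i) d.
have d40 : 0 <= 4 / d by rewrite divr_ge0// ltW.
have [bw pw] := @C1_bounded_tensor f df (4 / d) d40
  (fun i => @continuous_plateau R (a ord0 i) (b ord0 i) d)
  (fun i => @continuous_dplateau R (a ord0 i) (b ord0 i) d)
  (fun i => @is_derive_plateau R (a ord0 i) (b ord0 i) d)
  (fun i => @plateau_itv R (a ord0 i) (b ord0 i) d)
  (fun i => @normr_dplateau_le R (a ord0 i) (b ord0 i) d d0).
pose S (j : 'I_n) : set 'rV[R]_n := [set x | layer (a ord0 j) (b ord0 j) d (x ord0 j)].
pose L := \big[setU/set0]_(j < n) S j.
have LP x : ~ L x -> forall j, ~ S j x.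
  by rewrite /L -bigcup_seq => H j Sj; apply: H; exists j => //=; rewrite mem_index_enum.
have mS j : measurable (S j).
  have -> : S j = rV_coord j @^-1` layer (a ord0 j) (b ord0 j) d by [].
  rewrite -[X in measurable X]setTI; apply: measurable_rV_coord => //.
  by apply: measurableU; exact: measurable_itv.
have [mL sL] : measurable L /\ (mu (L `&` Omega) <= ((\sum_(j < n) (C + C)) * d)%:E)%E.
  rewrite mulr_suml /L.
  elim/big_rec2: _ => [|j c A _ [mA sA]]; first by rewrite set0I measure0.
  split; first exact: measurableU.
  rewrite setIUl; apply: (le_trans (measureU2 _ _ _)); [exact: measurableI|exact: measurableI|].
  rewrite EFinD; apply: leeD => //.
  rewrite (_ : S j `&` Omega =
    (slab j (a ord0 j) (a ord0 j + d)%R `&` Omega) `|`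
    (slab j (b ord0 j - d)%R (b ord0 j - d + d)%R `&` Omega)); last first.
    by rewrite -setIUl subrK.
  have mI c1 c2 : measurable (slab j c1 c2 `&` Omega).
    by apply: measurableI => //; exact: measurable_slab.
  apply: (le_trans (measureU2 _ _ _)) => //.
  by rewrite mulrDl EFinD; apply: leeD; exact: slabC.
have sL' : (mu (L `&` Omega) <= ((4 + \sum_(j < n) (C + C)) * d)%:E)%E.
  by apply: (le_trans sL); rewrite lee_fin ler_wpM2r ?(ltW d0)// lerDr.
exists (tensor f), L; split => //.
- case: bw => ? ? ? ? q; split => // j x; apply: le_trans (q j x) _.
  by rewrite ler_wpM2r ?invr_ge0 ?(ltW d0)// lerDl.
- move=> j x _ /LP/(_ j) Sj; rewrite pw /tensor (bigD1 j)//= /subst_factor eqxx.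
  by rewrite /df dplateau_out ?mul0r.
- apply: (@le_trans _ _ (\int[mu]_(x in Omega) (\1_L x)%:E)%E); last first.
    rewrite integral_indic//; apply: (le_trans sL').
    by rewrite lee_fin lerDr ltW.
  apply: ge0_le_integral => //.
  + apply: measurable_int; apply: dist_int => //; first exact: C1_int bw.
    by apply: indic_int; exact: measurable_box.
  + by apply/measurable_EFinP; exact: measurable_indic.
  + move=> x Ox; rewrite lee_fin.
    have f01 i : 0 <= f i (x ord0 i) <= 1 by exact: plateau_itv.
    have t0 : 0 <= tensor f x by apply: prodr_ge0 => i _; have /andP[] := f01 i.
    have t1 : tensor f x <= 1.
      rewrite -[leRHS](@big1_eq _ _ *%R 'I_n (index_enum 'I_n) predT).
      by apply: ler_prod => i _; exact: f01.
    have [xL|xL] := pselect (L x).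
      rewrite [\1_L x]indicE mem_set// indicE ler_norml.
      by case: (_ \in _) => /=; apply/andP; split; lra.
    rewrite [\1_L x]indicE memNset//= normr_le0 subr_eq0 indicE; apply/eqP.
    have [xab|xab] := pselect (box a b x).
      rewrite mem_set//= /tensor big1// => i _; apply: plateau_in => //.
      exact: LP xL i.
    rewrite memNset//=; have /existsNP[i xi] := xab.
    by rewrite /tensor (bigD1 i)//= /f plateau_notin ?mul0r.
Qed.

(** An instance of closedness with distance 0; it permits replacing a function by a representative
    that agrees with it on [Omega] only. *)
Lemma eq_recoverable v w : {in Omega, v =1 w} -> recoverable Omega v -> recoverable Omega w.
Proof.
move=> vw rv; have [iv _] := rv.
have iw : int w by apply: eq_integrable iv => // x xO; rewrite /= vw.
apply: recoverable_closed => // tau tau0; exists v => //.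
under eq_integral => x xO do rewrite vw// subrr normr0.
by rewrite integral0 lee_fin ltW.
Qed.

(** On [Omega] the constant 1 is the indicator of a large cube, which handles the whole space and
    complements. Disjoint unions are L^1 limits of finite sums, dominated by 1. *)
Lemma recoverable_indic (B : set 'rV[R]_n) : measurable B -> recoverable Omega (\1_B).
Proof.
rewrite measurable_boxesE; apply: (@dynkin_induction _ 'rV[R]_n (@boxes R n)
  (fun B => recoverable Omega (\1_B))).
- exact: measurable_boxesE.
- exact: setI_closed_boxes.
- have [r r0 Or] := bounded_set_cube bOmega.
  apply: eq_recoverable (recoverable_box (const_mx (- r)) (const_mx r)) => x.
  by rewrite inE => /Or xr; rewrite !indicE in_setT mem_set.
- by move=> _ [a [b ->]]; exact: recoverable_box.
- move=> S mS IH.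
  have [r r0 Or] := bounded_set_cube bOmega.
  have := recoverableD oOmega bOmega (recoverable_box (const_mx (- r)) (const_mx r))
    (recoverableZ oOmega bOmega (-1) IH).
  apply: eq_recoverable => x; rewrite inE => /Or xr.
  rewrite /= /GRing.scale/= !indicE in_setC (mem_set xr).
  by case: (x \in S); rewrite /= ?mulr1 ?mulr0 ?subrr ?addr0.
- move=> F mF tF IH.
  pose G N := \big[setU/set0]_(i < N) F i.
  have mG N : measurable (G N) by apply: bigsetU_measurable.
  have rG N : recoverable Omega (\1_(G N)).
    elim: N => [|N IHN].
      rewrite /G big_ord0; apply: eq_recoverable (recoverableZ oOmega bOmega 0 (IH 0%N)) => x _.
      by rewrite indic0 /= scale0r.
    apply: eq_recoverable (recoverableD oOmega bOmega IHN (IH N)) => x _.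
    rewrite /G big_ord_recr /= !indicE in_setU.
    (* Disjointness matters here: a point of [F N] lies in no earlier set, so the indicators add
       without overlap. *)
    case: (boolP (x \in F N)) => xF; rewrite ?orbF ?addr0//.
    rewrite memNset ?add0r//; rewrite -bigcup_mkord => -[i /= iN Fi].
    move: xF; rewrite inE => xF.
    have := tF i N Logic.I Logic.I; rewrite /= => /(_ (ex_intro _ x (conj Fi xF))) iNE.
    by rewrite iNE ltnn in iN.
  have mU : measurable (\bigcup_k F k) by exact: bigcupT_measurable.
  apply: recoverable_closed => //; first exact: indic_int.
  have mE N : measurable_fun Omega (EFin \o (\1_(G N) : 'rV[R]_n -> R)).
    by apply/measurable_EFinP; exact: measurable_indic.
  have mEU : measurable_fun Omega (EFin \o (\1_(\bigcup_k F k) : 'rV[R]_n -> R)).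
    by apply/measurable_EFinP; exact: measurable_indic.
  have cv : {ae mu, forall x, Omega x ->
    (EFin \o (\1_(G N) : 'rV[R]_n -> R)) x @[N --> \oo] --> (EFin \o (\1_(\bigcup_k F k) : 'rV[R]_n -> R)) x}.
    apply: aeW => x _; apply: cvg_near_cst.
    have [[k _ Fk]|xF] := pselect ((\bigcup_k F k) x).
      near=> N; rewrite /= !indicE mem_set ?[in RHS]mem_set//; first by exists k.
      by rewrite /G -bigcup_mkord; exists k => //=; near: N; exact: nbhs_infty_gt.
    apply: nearW => N; rewrite /= !indicE !memNset// /G -bigcup_mkord => -[i _ Fi].
    by apply: xF; exists i.
  have ub : {ae mu, forall x N, Omega x ->
      (`|(EFin \o (\1_(G N) : 'rV[R]_n -> R)) x| <= (EFin \o (\1_setT : 'rV[R]_n -> R)) x)%E}.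
    apply: aeW => x N _; rewrite /= lee_fin !indicE in_setT.
    by case: (_ \in _); rewrite /= ?normr1 ?normr0.
  have [_ + _] := dominated_convergence mOmega mE mEU cv (indic_int measurableT) ub.
  move=> cv0 tau tau0.
  have [N _ /(_ N (leqnn N)) /= HN] := cvg0_near_lt cv0 tau0.
  exists (\1_(G N)) => //; exact: ltW HN.
Unshelve. all: by end_near. Qed.

Import HBSimple.

(** Simple functions are dense in L^1, and each is a finite combination of the indicators of its
    level sets. *)
Lemma recoverable_integrable v : int v -> recoverable Omega v.
Proof.
move=> iv; have [g [ig _ cvg]] := approximation_sfun_integrable mOmega iv.
apply: recoverable_closed => // tau tau0.
have [N _ /(_ N (leqnn N)) /= HN] := cvg0_near_lt cvg tau0.
exists (g N); last first.
  apply: le_trans (ltW HN); under eq_integral do rewrite distrC.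
  by [].
suff H (s : seq R) : recoverable Omega
    (fun x => \sum_(y <- s) (y * \1_(g N @^-1` [set y]) x)).
  have := H (finmap.enum_fset (fset_set (range (g N)))); apply: eq_recoverable => x _.
  by rewrite [RHS]fimfunE fsbig_finite.
elim: s => [|y t IH].
  apply: eq_recoverable (recoverableZ oOmega bOmega 0 (recoverable_indic measurableT)) => x _.
  by rewrite big_nil /= scale0r.
have my : measurable (g N @^-1` [set y]).
  by rewrite -[X in measurable X]setTI; exact: measurable_funP.
apply: eq_recoverable (recoverableD oOmega bOmega
  (recoverableZ oOmega bOmega y (recoverable_indic my)) IH) => x _.
by rewrite big_cons.
Qed.

End recoverable_integrable.

(** * Recovery displacements and their energy *)

Section vector_recovery.
Context {R : realType} {n : nat}.
Local Notation mu := (lebesgue_rV n : {measure set 'rV[R]_n -> \bar R}).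
Variable Omega : set 'rV[R]_n.
Hypothesis oOmega : open Omega.
Hypothesis bOmega : bounded_set Omega.

Let mOmega : measurable Omega.
Proof. exact: open_measurable_rV. Qed.

Lemma normr_rV_le_sum (v : 'rV[R]_n) : `|v| <= \sum_i `|v ord0 i|.
Proof.
rewrite [`|v|]/Num.norm /= mx_normrE; apply/bigmax_leP; split.
  exact: sumr_ge0.
move=> [i j] _ /=; rewrite (ord1 i) (bigD1 j)//= lerDl.
exact: sumr_ge0.
Qed.

Lemma measurable_normr_rV (u : 'rV[R]_n -> 'rV[R]_n) :
  (forall i, measurable_fun Omega (fun x => u x ord0 i)) ->
  measurable_fun Omega (fun x => `|u x|).
Proof.
move=> mu_.
have -> : (fun x => `|u x|) = (fun x => \big[Num.max/0]_ij `|u x ij.1 ij.2|).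
  by apply/funext => x; rewrite [`|u x|]/Num.norm /= mx_normrE.
elim: (index_enum _) => [|[i j] s IH].
  by under eq_fun do rewrite big_nil; exact: measurable_cst.
under eq_fun do rewrite big_cons.
apply: measurable_maxr => //=; rewrite (ord1 i).
exact: measurableT_comp.
Qed.

(** Components are approximated independently, and the layer is the union of theirs; the sup norm is
    at most the sum of the absolute values of the components. *)
Lemma vector_recovery (u : 'rV[R]_n -> 'rV[R]_n) : L1_vector Omega u ->
  forall tau, 0 < tau -> exists2 C, 0 <= C & forall d, 0 < d < 1 ->
    exists w L, [/\ (forall i, C1_bounded (fun x : 'rV[R]_n => (w x : 'rV[R]_n) ord0 i) (C / d)),
      (forall i j x, Omega x -> ~ L x -> partial j (fun x => w x ord0 i) x = 0),
      measurable L, (mu (L `&` Omega) <= (C * d)%:E)%E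
      & (\int[mu]_(x in Omega) (`|w x - u x|)%:E <= (tau + C * d)%:E)%E].
Proof.
move=> iu tau tau0.
(* The [n] errors add up to n tau/(n+1), at most [tau]; the denominator n+1 is positive for every
   [n]. *)
have tn0 : 0 < tau / n.+1%:R by rewrite divr_gt0.
have rec i := (recoverable_integrable oOmega bOmega (iu i)).2 _ tn0.
have /choice[C HC] : forall i, exists C, 0 <= C /\ forall d, 0 < d < 1 ->
    exists p : ('rV[R]_n -> R) * set 'rV[R]_n, [/\ C1_bounded p.1 (C / d),
      (forall j x, Omega x -> ~ p.2 x -> partial j p.1 x = 0),
      measurable p.2, (mu (p.2 `&` Omega) <= (C * d)%:E)%E
      & (\int[mu]_(x in Omega) (`|p.1 x - u x ord0 i|%:E) <= (tau / n.+1%:R + C * d)%:E)%E].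
  move=> i; have [C C0 H] := rec i; exists C; split => // d d01.
  by have [w [L HwL]] := H d d01; exists (w, L).
exists (\sum_i C i); first by apply: sumr_ge0 => i _; have [] := HC i.
have leC i : C i <= \sum_i C i.
  by rewrite (bigD1 i)//= lerDl sumr_ge0// => j _; have [] := HC j.
move=> d d01; have /andP[d0 _] := d01.
have /choice[p Hp] := fun i => (HC i).2 d d01.
pose w (x : 'rV[R]_n) : 'rV[R]_n := \row_i (p i).1 x.
pose L := \big[setU/set0]_(i < n) (p i).2.
have wE i : (fun x => w x ord0 i) = (p i).1 by apply/funext => x; rewrite mxE.
have LP x : ~ L x -> forall j, ~ (p j).2 x.
  by rewrite /L -bigcup_seq => H j Sj; apply: H; exists j => //=; rewrite mem_index_enum.
exists w, L; split.
- move=> i; rewrite wE; have [[? ? ? ? q] _ _ _ _] := Hp i; split => // j x.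
  by rewrite (le_trans (q j x))// ler_wpM2r ?invr_ge0 ?(ltW d0).
- move=> i j x Ox /LP/(_ i) xL; rewrite wE; have [_ + _ _ _] := Hp i.
  exact.
- by apply: bigsetU_measurable => i _; have [] := Hp i.
- suff [] : measurable L /\ (mu (L `&` Omega) <= ((\sum_i C i) * d)%:E)%E by [].
  rewrite mulr_suml /L.
  elim/big_rec2: _ => [|j c A _ [mA sA]]; first by rewrite set0I measure0.
  have [_ _ mp sp _] := Hp j.
  split; first exact: measurableU.
  rewrite setIUl; apply: (le_trans (measureU2 _ _ _)); [exact: measurableI|exact: measurableI|].
  by rewrite EFinD; apply: leeD.
- have mwu i : measurable_fun Omega (fun x => (p i).1 x - u x ord0 i).
    apply: measurable_funB; last by apply/measurable_EFinP; exact: measurable_int (iu i).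
    by have [b _ _ _ _] := Hp i; exact: C1_measurable b.
  apply: (@le_trans _ _ (\int[mu]_(x in Omega) (\sum_(i < n) `|(p i).1 x - u x ord0 i|%:E))%E).
    apply: ge0_le_integral => //.
    + apply/measurable_EFinP; apply: measurable_normr_rV => i.
      by apply: eq_measurable_fun (mwu i) => x _; rewrite !mxE.
    + by apply: emeasurable_sum => i; apply/measurable_EFinP; exact: measurableT_comp.
    + move=> x Ox; rewrite sumEFin lee_fin; apply: le_trans (normr_rV_le_sum _) _.
      by apply: ler_sum => i _; rewrite !mxE.
  rewrite ge0_integral_sum//; last first.
    by move=> i; apply/measurable_EFinP; exact: measurableT_comp.
  apply: (@le_trans _ _ (\sum_(i < n) (tau / n.+1%:R + C i * d)%:E)%E).
    by apply: lee_sum => i _; have [] := Hp i.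
  rewrite sumEFin lee_fin big_split/= mulr_suml lerD2r sumr_const card_ord.
  rewrite -[_ *+ n]mulr_natr -mulrA ler_piMr ?(ltW tau0)//.
  by rewrite mulrC ler_pdivrMr ?mul1r ?ler_nat ?ltr0n.
Qed.

End vector_recovery.

(** * Measurability of the density and uniqueness of the weak gradient *)

Section energy_bounds.
Context {R : realType} {n : nat}.
Local Notation mu := (lebesgue_rV n : {measure set 'rV[R]_n -> \bar R}).
Variable Omega : set 'rV[R]_n.
Hypothesis oOmega : open Omega.
Hypothesis bOmega : bounded_set Omega.

Let mOmega : measurable Omega.
Proof. exact: open_measurable_rV. Qed.

Variables (Aw As : {linear 'M[R]_n -> 'M[R]_n}).

Lemma frobeniusE (A B : 'M[R]_n) : frobenius A B = \sum_i \sum_k A i k * B k i.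
Proof. by rewrite /frobenius /mxtrace; apply: eq_bigr => i _; rewrite mxE. Qed.

(** The product is tr(AB) without a transpose, so it is a sum of squares only on symmetric
    matrices. *)
Lemma frobenius_sym_ge0 (A : 'M[R]_n) : symmetric_mx A -> 0 <= frobenius A A.
Proof.
move=> sA; rewrite frobeniusE; apply: sumr_ge0 => i _; apply: sumr_ge0 => k _.
by rewrite -[in X in _ * X]sA mxE -expr2 sqr_ge0.
Qed.

Lemma frobenius_normK (A : 'M[R]_n) : symmetric_mx A ->
  frobenius_norm A ^+ 2 = frobenius A A.
Proof. by move=> sA; rewrite sqr_sqrtr// frobenius_sym_ge0. Qed.

Lemma frobenius_bound (A : 'M[R]_n) K : (forall i j, `|A i j| <= K) ->
  frobenius A A <= n%:R * (n%:R * K ^+ 2).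
Proof.
move=> AK; rewrite frobeniusE.
apply: (@le_trans _ _ (\sum_(i < n) \sum_(k < n) K ^+ 2)).
  apply: ler_sum => i _; apply: ler_sum => k _.
  by rewrite (le_trans (ler_norm _))// normrM expr2 ler_pM.
by rewrite !sumr_const card_ord -[K ^+ 2 *+ n]mulr_natl -[leLHS]mulr_natl.
Qed.

Definition mx_sym (G : 'M[R]_n) : 'M[R]_n := 2^-1 *: (G + G^T).

Lemma mx_symP G : symmetric_mx (mx_sym G).
Proof. by rewrite /symmetric_mx /mx_sym linearZ/= linearD/= trmxK addrC. Qed.

(** Shaped so that the elastic integrand of [energy] is an instance of it by conversion, with
    [mx_sym] of the weak gradient for [e]. *)
Definition density (c : R) (eta : R) (e : 'M[R]_n) : R :=
  frobenius ((eta * c) *: Aw e + (1 - c) *: As e) e.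

Lemma densityE c eta e :
  density c eta e = eta * c * frobenius (Aw e) e + (1 - c) * frobenius (As e) e.
Proof. by rewrite /density /frobenius mulmxDl -!scalemxAl linearD/= !linearZ. Qed.

Lemma measurable_linear_entry (A : {linear 'M[R]_n -> 'M[R]_n}) (G : 'rV[R]_n -> 'M[R]_n) i k :
  (forall i j, measurable_fun Omega (fun x => G x i j)) ->
  measurable_fun Omega (fun x => A (G x) i k).
Proof.
move=> mG.
have -> : (fun x => A (G x) i k) =
    (fun x => \sum_a \sum_b G x a b * A (delta_mx a b) i k).
  apply/funext => x; rewrite [in LHS](matrix_sum_delta (G x)) linear_sum summxE.
  apply: eq_bigr => a _; rewrite linear_sum summxE; apply: eq_bigr => b _.
  by rewrite linearZ mxE.
apply: measurable_sum => a; apply: measurable_sum => b.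
by apply: measurable_funM => //; exact: measurable_cst.
Qed.

Lemma measurable_frobenius (F G : 'rV[R]_n -> 'M[R]_n) :
  (forall i j, measurable_fun Omega (fun x => F x i j)) ->
  (forall i j, measurable_fun Omega (fun x => G x i j)) ->
  measurable_fun Omega (fun x => frobenius (F x) (G x)).
Proof.
move=> mF mG; under eq_fun do rewrite frobeniusE.
by apply: measurable_sum => a; apply: measurable_sum => b; exact: measurable_funM.
Qed.

Lemma measurable_mx_sym (G : 'rV[R]_n -> 'M[R]_n) :
  (forall i j, measurable_fun Omega (fun x => G x i j)) ->
  forall i j, measurable_fun Omega (fun x => mx_sym (G x) i j).
Proof.
move=> mG i j.
have -> : (fun x => mx_sym (G x) i j) = (fun x => 2^-1 * (G x i j + G x j i)).
  by apply/funext => x; rewrite !mxE.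
by apply: measurable_funM; [exact: measurable_cst|exact: measurable_funD].
Qed.

Lemma measurable_density eta (chi : 'rV[R]_n -> R) (G : 'rV[R]_n -> 'M[R]_n) :
  measurable_fun Omega chi ->
  (forall i j, measurable_fun Omega (fun x => G x i j)) ->
  measurable_fun Omega (fun x => density (chi x) eta (mx_sym (G x))).
Proof.
move=> mchi mG; have mS := measurable_mx_sym mG.
under eq_fun do rewrite densityE.
by apply: measurable_funD; apply: measurable_funM;
  [apply: measurable_funM => //; exact: measurable_cst|
   apply: measurable_frobenius => // i j; exact: measurable_linear_entry|
   apply: measurable_funB => //; exact: measurable_cst|
   apply: measurable_frobenius => // i j; exact: measurable_linear_entry].
Qed.

(** |f| is at most 1 + |f|^2, and constants are integrable on the bounded set [Omega]. *)
Lemma L2_integrable (f : 'rV[R]_n -> R) : L2 Omega f -> mu.-integrable Omega (EFin \o f).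
Proof.
move=> [mf f2].
have i1 : mu.-integrable Omega (EFin \o (fun _ : 'rV[R]_n => 1 : R)).
  apply: (@bounded_int _ _ _ oOmega bOmega _ 1); first exact: measurable_cst.
  by move=> x; rewrite normr1.
have i2 : mu.-integrable Omega (EFin \o (fun x => `|f x| ^+ 2)).
  apply/integrableP; split.
    by apply/measurable_EFinP; apply: measurable_funX; exact: measurableT_comp.
  apply: le_lt_trans f2; rewrite le_eqVlt; apply/orP; left; apply/eqP.
  by apply: eq_integral => x _; rewrite /= ger0_norm// exprn_ge0.
apply: le_integrable (integrableD mOmega i1 i2) => //; first exact/measurable_EFinP.
move=> x _ /=; rewrite lee_fin [leRHS]ger0_norm ?addr_ge0 ?exprn_ge0//.
by have := sqr_ge0 (`|f x| - 2^-1); have := normr_ge0 (f x); nra.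
Qed.

Lemma weak_gradientP u : H1 Omega u -> is_weak_gradient Omega u (weak_gradient Omega u).
Proof. by move=> [_ ex]; exact: getPex. Qed.

(** The energy sees only the gradient selected by [get]; this identifies it almost everywhere with
    any explicit one. Entries are compared separately and finitely many null sets are united. *)
Lemma weak_gradient_unique u g : H1 Omega u -> is_weak_gradient Omega u g ->
  {ae mu, forall x, Omega x -> weak_gradient Omega u x = g x}.
Proof.
move=> /weak_gradientP H Hg.
have ae_ij ij : {ae mu, forall x, Omega x ->
    weak_gradient Omega u x ij.1 ij.2 = g x ij.1 ij.2}.
  have [L2a Ha] := H ij.1 ij.2; have [L2b Hb] := Hg ij.1 ij.2.
  apply: ae_eq_test_functions => //; [exact: L2_integrable|exact: L2_integrable|].
  by move=> phi tphi; apply: oppe_inj; rewrite -Ha// -Hb.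
have : \forall x \ae mu, forall ij : 'I_n * 'I_n, Omega x ->
    weak_gradient Omega u x ij.1 ij.2 = g x ij.1 ij.2.
  exact: filter_forall ae_ij.
apply: filterS => x Hx Ox; apply/matrixP => i j; exact: (Hx (i, j)).
Qed.

Lemma C1_H1 (w : 'rV[R]_n -> 'rV[R]_n) K :
  (forall i, C1_bounded (fun x => w x ord0 i) K) ->
  H1 Omega w /\
  is_weak_gradient Omega w (fun x => \matrix_(i, j) partial j (fun x => w x ord0 i) x).
Proof.
move=> cw.
have bL2 (f : 'rV[R]_n -> R) M : measurable_fun Omega f -> (forall x, `|f x| <= M) -> L2 Omega f.
  move=> mf fM; split => //.
  have : mu.-integrable Omega (EFin \o (fun x => `|f x| ^+ 2)).
    apply: (@bounded_int _ _ _ oOmega bOmega _ (M ^+ 2)).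
      by apply: measurable_funX; exact: measurableT_comp.
    by move=> x; rewrite normrX normr_id lerXn2r// nnegrE (le_trans _ (fM x)).
  move=> /integrableP[_]; apply: le_lt_trans; rewrite le_eqVlt; apply/orP; left; apply/eqP.
  by apply: eq_integral => x _; rewrite /= [in RHS]normrX normr_id.
have wg : is_weak_gradient Omega w (fun x => \matrix_(i, j) partial j (fun x => w x ord0 i) x).
  move=> i j; have [c1 c2 c3 [M c4] c5] := cw i.
  have -> : (fun x => (\matrix_(i, j) partial j (fun x => w x ord0 i) x) i j) =
     partial j (fun x => w x ord0 i) by apply/funext => x; rewrite mxE.
  split.
    by apply: (bL2 _ K) => //; exact: continuous_measurable_rV.
  move=> phi tphi.
  rewrite (weak_derivative_classical tphi mOmega c1 (c3 j) (c2 j) c4 (c5 j)).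
  by congr (- _)%E; apply: eq_integral => x _; rewrite mxE.
split => //; split; last by eexists; exact: wg.
move=> i; have [c1 _ _ [M c4] _] := cw i.
by apply: (bL2 _ M) => //; exact: continuous_measurable_rV.
Qed.

End energy_bounds.

(** * Bounds on the energy from below and above *)

Section energy_estimates.
Context {R : realType} {n : nat}.
Local Notation mu := (lebesgue_rV n : {measure set 'rV[R]_n -> \bar R}).
Variable Omega : set 'rV[R]_n.
Hypothesis oOmega : open Omega.
Hypothesis bOmega : bounded_set Omega.

Let mOmega : measurable Omega.
Proof. exact: open_measurable_rV. Qed.

Variables (Aw As : {linear 'M[R]_n -> 'M[R]_n}) (cw' kappa : R) (eta : R -> R).
Hypothesis cw'_ge0 : 0 <= cw'.
Hypothesis Aw_ge0 : forall xi : 'M[R]_n, symmetric_mx xi -> 0 <= frobenius (Aw xi) xi.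
Hypothesis As_ge0 : forall xi : 'M[R]_n, symmetric_mx xi -> 0 <= frobenius (As xi) xi.
Hypothesis Aw_le : forall xi : 'M[R]_n, symmetric_mx xi ->
  frobenius (Aw xi) xi <= cw' * frobenius xi xi.
Hypothesis kappa_gt0 : 0 < kappa.

Local Notation E := (energy Omega Aw As kappa eta).

Lemma density_ge0 c e xi : 0 <= e -> c = 0 \/ c = 1 -> symmetric_mx xi ->
  0 <= density Aw As c e xi.
Proof.
move=> e0 c01 sxi; rewrite densityE.
have := Aw_ge0 sxi; have := As_ge0 sxi.
by case: c01 => -> a b; nra.
Qed.

Lemma measurable_weak_gradient u : H1 Omega u ->
  forall i j, measurable_fun Omega (fun x => weak_gradient Omega u x i j).
Proof. by move=> /weak_gradientP H i j; have [[]] := H i j. Qed.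

(** The phase takes the values 0 and 1 only almost everywhere, so the integrand is first replaced by
    its absolute value, equal to it off a null set. *)
Lemma integral_density_ge0 eps u chi : 0 <= eta eps -> H1 Omega u ->
  phase_field Omega chi ->
  (0 <= \int[mu]_(x in Omega)
    (density Aw As (chi x) (eta eps) (mx_sym (weak_gradient Omega u x)))%:E)%E.
Proof.
move=> e0 Hu [mchi chi01].
set f := fun x => density Aw As (chi x) (eta eps) (mx_sym (weak_gradient Omega u x)).
have mf : measurable_fun Omega f.
  by apply: measurable_density => //; exact: measurable_weak_gradient.
have -> : (\int[mu]_(x in Omega) (f x)%:E = \int[mu]_(x in Omega) (`|f x|)%:E)%E.
  apply: ae_eq_integral => //; [exact/measurable_EFinP| |].
    by apply/measurable_EFinP; exact: measurableT_comp.
  apply: filterS chi01 => x /= H Ox; congr EFin; rewrite ger0_norm//.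
  by apply: density_ge0 => //; [exact: H|exact: mx_symP].
by apply: integral_ge0 => x _; rewrite lee_fin.
Qed.

Lemma phase_field_integral chi : phase_field Omega chi ->
  (\int[mu]_(x in Omega) (chi x)%:E = \int[mu]_(x in Omega) (`|chi x|)%:E)%E.
Proof.
move=> [mchi chi01]; apply: ae_eq_integral => //; [exact/measurable_EFinP| |].
  by apply/measurable_EFinP; exact: measurableT_comp.
apply: filterS chi01 => x /= H Ox; congr EFin.
by case: (H Ox) => ->; rewrite ?normr0 ?normr1.
Qed.

Lemma energy_lower_bound eps u chi : 0 < eps -> 0 < eta eps ->
  ((kappa / eps)%:E * \int[mu]_(x in Omega) (`|chi x|)%:E <= E eps u chi)%E.
Proof.
move=> eps0 eta0; rewrite /energy; case: asboolP => [[Hu Hchi]|_]; last exact: leey.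
rewrite (phase_field_integral Hchi).
apply: leeDr; apply: mule_ge0; first by rewrite lee_fin.
exact: (integral_density_ge0 (ltW eta0) Hu Hchi).
Qed.

Lemma energy_ge0 eps u chi : 0 < eps -> 0 < eta eps -> (0 <= E eps u chi)%E.
Proof.
move=> eps0 eta0; apply: le_trans (energy_lower_bound u chi eps0 eta0).
apply: mule_ge0; first by rewrite lee_fin divr_ge0// ltW.
by apply: integral_ge0 => x _; rewrite lee_fin.
Qed.

(** With the indicator of [L] as phase, the strong tensor acts only where the gradient vanishes.
    What remains is the weak term, with n^2 entries of size at most C/d on a set of measure at most
    Cd, and the cost of the phase. *)
Lemma energy_upper_bound eps w L C d : 0 < eps -> 0 < eta eps -> 0 < d -> 0 <= C ->
  (forall i, C1_bounded (fun x : 'rV[R]_n => (w x : 'rV[R]_n) ord0 i) (C / d)) ->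
  (forall i j x, Omega x -> ~ L x -> partial j (fun x => w x ord0 i) x = 0) ->
  measurable L -> (mu (L `&` Omega) <= (C * d)%:E)%E ->
  (E eps w (\1_L) <= (2^-1 * (eta eps * cw' * (n%:R * (n%:R * (C / d) ^+ 2)) * (C * d))
     + kappa / eps * (C * d))%:E)%E.
Proof.
move=> eps0 eta0 d0 C0 cw w0 mL sL.
have [Hw wgw] := C1_H1 oOmega bOmega cw.
have mchi : measurable_fun Omega (\1_L : 'rV[R]_n -> R) by exact: measurable_indic.
have Hchi : phase_field Omega (\1_L).
  split => //; apply: aeW => x Ox; rewrite indicE.
  by case: (_ \in _); [right|left].
rewrite /energy asboolT//.
set g := fun x => \matrix_(i, j) partial j (fun x => w x ord0 i) x.
have gK x i j : `|g x i j| <= C / d by rewrite mxE; have [_ _ _ _] := cw i; apply.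
set B := n%:R * (n%:R * (C / d) ^+ 2).
have B0 : 0 <= B by rewrite mulr_ge0// mulr_ge0// sqr_ge0.
have mg i j : measurable_fun Omega (fun x => g x i j).
  under eq_fun do rewrite mxE.
  by have [_ _ c _ _] := cw i; exact: continuous_measurable_rV.
have pt x : Omega x -> 0 <= density Aw As (\1_L x) (eta eps) (mx_sym (g x)) <=
    eta eps * cw' * B * \1_L x.
  move=> Ox; have sg := mx_symP (g x); apply/andP; split.
    apply: density_ge0 => //; first exact: ltW.
    by rewrite indicE; case: (_ \in _); [right|left].
  rewrite densityE indicE; have [xL|xL] := pselect (L x).
    rewrite mem_set//= subrr mul0r addr0 !mulr1 -!mulrA ler_pM2l//.
    apply: le_trans (Aw_le sg) _; rewrite ler_wpM2l//; apply: frobenius_bound => i j.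
    rewrite !mxE; have := gK x i j; have := gK x j i; rewrite !mxE !ler_norml.
    by move=> /andP[? ?] /andP[? ?]; apply/andP; split; lra.
  rewrite memNset//= mulr0 mul0r add0r subr0 mul1r mulr0.
  have -> : mx_sym (g x) = 0.
    by apply/matrixP => i j; rewrite !mxE !w0// addr0 mulr0.
  by rewrite /frobenius mulmx0 mxtrace0.
(* The selected weak gradient is exchanged for the classical gradient [g], on which the pointwise
   bound [pt] is available. *)
have -> : (\int[mu]_(x in Omega) (frobenius
     ((eta eps * \1_L x) *: Aw (sym_gradient Omega w x)
        + (1 - \1_L x) *: As (sym_gradient Omega w x)) (sym_gradient Omega w x))%:E =
    \int[mu]_(x in Omega) (density Aw As (\1_L x) (eta eps) (mx_sym (g x)))%:E)%E.
  apply: ae_eq_integral => //.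
  - apply/measurable_EFinP.
    exact: (measurable_density Aw As (eta eps) mchi (measurable_weak_gradient Hw)).
  - by apply/measurable_EFinP; exact: measurable_density.
  - have := weak_gradient_unique oOmega bOmega Hw wgw.
    by apply: filterS => x /= H Ox; rewrite /sym_gradient H.
have iL : (\int[mu]_(x in Omega) (\1_L x)%:E <= (C * d)%:E)%E by rewrite integral_indic.
rewrite EFinD; apply: leeD; rewrite [leRHS]EFinM; apply: lee_pmul => //.
- by apply: integral_ge0 => x Ox; rewrite lee_fin; have /andP[] := pt x Ox.
- apply: (@le_trans _ _ (\int[mu]_(x in Omega) ((eta eps * cw' * B)%:E * (\1_L x)%:E))%E).
    apply: ge0_le_integral => //.
    + by move=> x Ox; rewrite lee_fin; have /andP[] := pt x Ox.
    + by apply/measurable_EFinP; exact: measurable_density.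
    + by apply: measurable_funeM; exact/measurable_EFinP.
    + by move=> x Ox; rewrite -EFinM lee_fin; have /andP[] := pt x Ox.
  have K0 : (0 <= (eta eps * cw' * B)%:E)%E.
    by rewrite lee_fin mulr_ge0// mulr_ge0// ltW.
  have mI : measurable_fun Omega (fun x => (\1_L x)%:E : \bar R) by exact/measurable_EFinP.
  rewrite ge0_integralZl//.
  by rewrite [leRHS]EFinM; apply: lee_pmul => //; apply: integral_ge0 => x _; rewrite lee_fin.
- by rewrite lee_fin divr_ge0// ltW.
- by apply: integral_ge0 => x _; rewrite lee_fin.
Qed.

End energy_estimates.

(** * Lower and upper limits along a filter *)

Section lower_upper_limits.
Context {R : realType} {X : choiceType} {T : filteredType X}.
Variables (F : set_system T) (f : T -> \bar R).
Context {FF : ProperFilter F}.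

Lemma limf_esup_le a : (\forall x \near F, (f x <= a)%E) -> (limf_esup f F <= a)%E.
Proof.
move=> fa; rewrite limf_esupE; apply: ge_ereal_inf.
exists (ereal_sup (f @` [set x | (f x <= a)%E])); first by exists [set x | (f x <= a)%E].
by apply/ereal_supP => _ [x xa <-].
Qed.

Lemma limf_einf_le a : (\forall x \near F, (f x <= a)%E) -> (limf_einf f F <= a)%E.
Proof.
move=> fa; rewrite limf_einfE; apply/ereal_supP => _ [V FV <-].
have [x [Vx xa]] := filter_ex (filterI FV fa).
by apply: ge_ereal_inf; exists (f x) => //; exists x.
Qed.

Lemma limf_esup_ge a : (\forall x \near F, (a <= f x)%E) -> (a <= limf_esup f F)%E.
Proof.
move=> fa; rewrite limf_esupE; apply/ereal_infP => _ [V FV <-].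
have [x [Vx xa]] := filter_ex (filterI FV fa).
by apply: (le_trans xa); apply: ereal_sup_ubound; exists x.
Qed.

Lemma limf_einf_ge a : (\forall x \near F, (a <= f x)%E) -> (a <= limf_einf f F)%E.
Proof.
move=> fa; rewrite limf_einfE; apply: le_ereal_sup_tmp.
exists (ereal_inf (f @` [set x | (a <= f x)%E])); first by exists [set x | (a <= f x)%E].
by apply/ereal_infP => _ [x xa <-].
Qed.

(** Plays the part of extracting a subsequence with bounded energy. The upper limit gives the same
    conclusion, so one compactness argument covers both Gamma-limits. *)
Lemma limf_einf_lt_frequently a : (limf_einf f F < a)%E ->
  forall V, F V -> exists2 x, V x & (f x < a)%E.
Proof.
rewrite limf_einfE => lta V FV.
have : (ereal_inf (f @` V) < a)%E.
  by apply: le_lt_trans lta; apply: ereal_sup_ubound; exists V.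
by move=> /ereal_inf_lt[_ [x Vx <-] fxa]; exists x.
Qed.

Lemma limf_esup_lt_frequently a : (limf_esup f F < a)%E ->
  forall V, F V -> exists2 x, V x & (f x < a)%E.
Proof.
rewrite limf_esupE => /ereal_inf_lt[_ [W FW <-] Wa] V FV.
have [x [Vx Wx]] := filter_ex (filterI FV FW).
exists x => //; apply: le_lt_trans Wa; apply: ereal_sup_ubound; by exists x.
Qed.

End lower_upper_limits.

(** * The Gamma-limit *)

Section near_optimal_choice.
Context {R : realType} {T : Type}.
Variables (good : set T) (cost : R -> T -> \bar R).
Hypothesis good_neq0 : good !=set0.
Hypothesis cost_ge0 : forall e t, 0 < e -> good t -> (0 <= cost e t)%E.

(* Replaces a diagonal argument: [f e] is a minimizer of the cost up to [e]. *)
Lemma near_optimal_choice :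
  (forall tau, 0 < tau -> \forall e \near 0^'+, exists2 t, good t & (cost e t <= tau%:E)%E) ->
  exists2 f : R -> T, (forall e, good (f e)) &
    forall tau, 0 < tau -> \forall e \near 0^'+, (cost e (f e) <= tau%:E)%E.
Proof.
move=> H.
pose m e := ereal_inf (cost e @` good).
have /choice[f fP] : forall e : R, exists t, good t /\
    (0 < e -> (m e < +oo)%E -> (cost e t < m e + e%:E)%E).
  move=> e; have [t0 gt0] := good_neq0.
  have [e0|e0] := ltP 0 e; last by exists t0; split.
  have [moo|moo] := pselect (m e < +oo)%E; last by exists t0; split.
  have m0 : (0 <= m e)%E by apply/ereal_infP => _ [t gt <-]; exact: cost_ge0.
  have mfin : m e \is a fin_num by rewrite ge0_fin_numE.
  by have [_ [t gt <-] ct] := lb_ereal_inf_adherent e0 mfin; exists t.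
exists f; first by move=> e; have [] := fP e.
move=> tau tau0; have tau20 : 0 < tau / 2 by rewrite divr_gt0.
near=> e.
have e0 : 0 < e by near: e; exact: nbhs_right_gt.
have [t gt ct] : exists2 t, good t & (cost e t <= (tau / 2)%:E)%E by near: e; exact: H.
have mt : (m e <= (tau / 2)%:E)%E by apply: ge_ereal_inf; exists (cost e t) => //; exists t.
have [_ /(_ e0 (le_lt_trans mt (ltry _)))/ltW/le_trans] := fP e; apply.
rewrite [tau]splitr EFinD; apply: leeD => //; rewrite lee_fin ltW//.
Unshelve. all: by end_near. Qed.

End near_optimal_choice.

Section gamma_limit.
Context {R : realType} {n : nat}.
Local Notation mu := (lebesgue_rV n : {measure set 'rV[R]_n -> \bar R}).
Variable Omega : set 'rV[R]_n.
Hypothesis oOmega : open Omega.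
Hypothesis bOmega : bounded_set Omega.

Let mOmega : measurable Omega.
Proof. exact: open_measurable_rV. Qed.

Variables (Aw As : {linear 'M[R]_n -> 'M[R]_n}) (cw' kappa : R) (eta : R -> R).
Hypothesis cw'_ge0 : 0 <= cw'.
Hypothesis Aw_ge0 : forall xi : 'M[R]_n, symmetric_mx xi -> 0 <= frobenius (Aw xi) xi.
Hypothesis As_ge0 : forall xi : 'M[R]_n, symmetric_mx xi -> 0 <= frobenius (As xi) xi.
Hypothesis Aw_le : forall xi : 'M[R]_n, symmetric_mx xi ->
  frobenius (Aw xi) xi <= cw' * frobenius xi xi.
Hypothesis kappa_gt0 : 0 < kappa.
Hypothesis eta_gt0 : forall eps, 0 < eps -> 0 < eta eps.

Local Notation E := (energy Omega Aw As kappa eta).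

(** An energy below [M] forces the integral of |chi_eps| under eps (|M| + 1)/kappa; for small eps
    this phase is close to both 0 and [chi] in L^1. *)
Lemma limit_phase_eq0 ueps chieps u chi (M : R) :
  L1_scalar Omega chi -> L1_converging Omega ueps chieps u chi ->
  (forall V, (0^'+)%R V -> exists2 eps, V eps & (E eps (ueps eps) (chieps eps) < M%:E)%E) ->
  {ae mu, forall x, Omega x -> chi x = 0}.
Proof.
move=> ichi [iL1 _ cchi] freq.
have M0 : 0 < `|M| + 1 by rewrite ltr_wpDl.
have mchi : measurable_fun Omega (EFin \o chi) := measurable_int _ ichi.
suff I0 : (\int[mu]_(x in Omega) `|(EFin \o chi) x| = 0)%E.
  have [H _] := ae_eq_integral_abs mu mOmega mchi.
  by apply: filterS (H I0) => x /= Hx Ox; have := Hx Ox; case.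
apply/eqP; rewrite eq_le; apply/andP; split; last by apply: integral_ge0.
apply/lee_addgt0Pr => tau tau0; rewrite add0e.
have tau20 : 0 < tau / 2 by rewrite divr_gt0.
(* Below this threshold the bound eps (|M| + 1)/kappa is at most tau/2; |M| + 1 is positive whatever
   the sign of [M]. *)
have s0 : 0 < tau / 2 * kappa / (`|M| + 1) by rewrite divr_gt0// mulr_gt0.
have [eps [[eps0 epss] chi_close] EM] := freq [set eps | (0 < eps /\
    eps < tau / 2 * kappa / (`|M| + 1)) /\
    (\int[mu]_(x in Omega) (`|chieps eps x - chi x|)%:E < (tau / 2)%:E)%E]
  (filterI (filterI (nbhs_right_gt 0) (nbhs_right_lt s0)) (cvg0_near_lt cchi tau20)).
have [_ ichieps] := iL1 _ eps0.
have mce := measurable_int _ ichieps.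
have lb := energy_lower_bound oOmega kappa Aw_ge0 As_ge0 (ueps eps) (chieps eps)
  eps0 (eta_gt0 eps0).
set I := (\int[mu]_(x in Omega) (`|chieps eps x|)%:E)%E in lb.
have I0 : (0 <= I)%E by apply: integral_ge0 => x _; rewrite lee_fin.
have Ile : (I <= (tau / 2)%:E)%E.
  have Ifin : I \is a fin_num.
    by apply: integrable_fin_num => //; exact: integrable_norm.
  have := le_lt_trans lb EM; rewrite -(fineK Ifin) -EFinM lte_fin lee_fin => H.
  have {}H : kappa / eps * fine I < `|M| + 1.
    by rewrite (lt_le_trans H)// (le_trans (ler_norm _))// lerDl.
  have : fine I < eps * (`|M| + 1) / kappa.
    rewrite ltr_pdivlMr// mulrC -ltr_pdivrMl// mulrA [_^-1 * _]mulrC.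
    exact: H.
  move=> /ltW/le_trans; apply.
  rewrite ler_pdivrMr// -ler_pdivlMr//; exact: ltW.
apply: (@le_trans _ _ (\int[mu]_(x in Omega) (`|chieps eps x - chi x|)%:E + I)%E); last first.
  by rewrite [tau]splitr EFinD; apply: leeD => //; exact: ltW.
rewrite -ge0_integralD//.
- apply: ge0_le_integral => //.
  + exact: measurableT_comp.
  + apply/measurable_EFinP; apply: measurable_funD; apply: measurableT_comp => //.
      by apply: measurable_funB; exact/measurable_EFinP.
    exact/measurable_EFinP.
  + move=> x _; rewrite /= lee_fin.
    by rewrite -[chi x](subKr (chieps eps x)) addrC (le_trans (ler_normB _ _))// ?subKr.
- apply/measurable_EFinP; apply: measurableT_comp => //.
  by apply: measurable_funB; exact/measurable_EFinP.
- by apply/measurable_EFinP; apply: measurableT_comp => //; exact/measurable_EFinP.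
Qed.

Hypothesis eta_cvg0 : eta eps @[eps --> 0^'+] --> 0.
Hypothesis alpha_eq0 : eta eps / eps @[eps --> 0^'+] --> 0.

Lemma layer_width_cvg0 : Num.sqrt (eta eps * eps) @[eps --> 0^'+] --> (0 : R).
Proof.
rewrite -[X in _ --> X](@sqrtr0 R).
apply: continuous_cvg; first exact: sqrt_continuous.
rewrite -[X in _ --> X](mulr0 0); apply: cvgM => //.
exact: cvg_at_right_filter cvg_id.
Qed.

Lemma energy_rate_cvg0 : Num.sqrt (eta eps / eps) @[eps --> 0^'+] --> (0 : R).
Proof.
rewrite -[X in _ --> X](@sqrtr0 R).
by apply: continuous_cvg; first exact: sqrt_continuous.
Qed.

(** Adding both L^1 distances to the energy lets a single near minimizer control convergence and
    energy at once. *)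
Definition recovery_cost (u : 'rV[R]_n -> 'rV[R]_n) (chi : 'rV[R]_n -> R) (eps : R)
    (p : ('rV[R]_n -> 'rV[R]_n) * ('rV[R]_n -> R)) : \bar R :=
  (\int[mu]_(x in Omega) (`|p.1 x - u x|)%:E
   + \int[mu]_(x in Omega) (`|p.2 x - chi x|)%:E + E eps p.1 p.2)%E.

Lemma recovery_cost_small u chi tau : L1_vector Omega u -> L1_scalar Omega chi ->
  {ae mu, forall x, Omega x -> chi x = 0} -> 0 < tau ->
  \forall eps \near 0^'+, exists2 p, L1_vector Omega p.1 /\ L1_scalar Omega p.2 &
    (recovery_cost u chi eps p <= tau%:E)%E.
Proof.
move=> iu ichi chi0 tau0.
have tau40 : 0 < tau / 4 by rewrite divr_gt0.
have [C C0 HC] := vector_recovery oOmega bOmega iu tau40.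
(* The factor left in [energy_upper_bound] once eta/d and d/eps are both replaced by their common
   value [r]. The budget is tau/4 for the displacement, tau/4 for the two errors Cd, and tau/4 for K
   r. *)
pose K := 2^-1 * (cw' * (n%:R * (n%:R * C ^+ 2)) * C) + kappa * C.
have K0 : 0 <= K.
  by rewrite addr_ge0// ?mulr_ge0// ?exprn_ge0// ltW.
have dlt (t : R) : 0 < t -> \forall eps \near 0^'+, Num.sqrt (eta eps * eps) < t.
  by move=> t0; move/cvgr_lt: layer_width_cvg0; exact.
have Cp : 0 < 2 * C + 1 by rewrite ltr_wpDl// mulr_ge0.
have Kp : 0 < K + 1 by rewrite ltr_wpDl.
near=> eps.
have eps0 : 0 < eps by near: eps; exact: nbhs_right_gt.
have eta0 := eta_gt0 eps0.
set d := Num.sqrt (eta eps * eps).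
set r := Num.sqrt (eta eps / eps).
have d0 : 0 < d by rewrite sqrtr_gt0 mulr_gt0.
have d1 : d < 1 by rewrite /d; near: eps; exact: dlt.
have Cd : 2 * C * d <= tau / 4.
  have : d < tau / 4 / (2 * C + 1) by rewrite /d; near: eps; apply: dlt; rewrite divr_gt0.
  rewrite ltr_pdivlMr// => /ltW; apply: le_trans.
  by rewrite [leRHS]mulrC ler_wpM2r ?(ltW d0)// lerDl.
have Kr : K * r <= tau / 4.
  have : r < tau / 4 / (K + 1).
    rewrite /r; near: eps; move/cvgr_lt: energy_rate_cvg0; apply.
    by rewrite divr_gt0.
  rewrite ltr_pdivlMr// => /ltW; apply: le_trans.
  by rewrite [leRHS]mulrC ler_wpM2r ?sqrtr_ge0// lerDl.
have [|w [L [cw w0 mL sL wu]]] := HC d; first by rewrite d0.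
exists (w, \1_L).
  split; first by move=> i; exact: C1_int (cw i).
  exact: indic_int.
have Ele := energy_upper_bound oOmega bOmega cw'_ge0 Aw_ge0 As_ge0 Aw_le kappa_gt0
  eps0 eta0 d0 C0 cw w0 mL sL.
have chile : (\int[mu]_(x in Omega) (`|\1_L x - chi x|)%:E <= (C * d)%:E)%E.
  rewrite (_ : (\int[mu]_(x in Omega) _)%E = (\int[mu]_(x in Omega) (\1_L x)%:E)%E).
    by rewrite integral_indic.
  have mchi : measurable_fun Omega chi by apply/measurable_EFinP; exact: measurable_int ichi.
  apply: ae_eq_integral => //.
  - apply/measurable_EFinP; apply: measurableT_comp => //.
    by apply: measurable_funB => //; exact: measurable_indic.
  - by apply/measurable_EFinP; exact: measurable_indic.
  - apply: filterS chi0 => x /= H Ox; rewrite H// subr0 ger0_norm//.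
apply: (@le_trans _ _ ((tau / 4 + C * d)%:E + (C * d)%:E +
  (2^-1 * (eta eps * cw' * (n%:R * (n%:R * (C / d) ^+ 2)) * (C * d))
     + kappa / eps * (C * d))%:E)%E).
  by apply: leeD => //; apply: leeD.
have rd : r = eta eps / d.
  rewrite /r /d sqrtrM ?(ltW eta0)// sqrtrM ?(ltW eta0)// sqrtrV ?(ltW eps0)//.
  rewrite invfM mulrA; congr (_ * _).
  by rewrite -{2}(sqr_sqrtr (ltW eta0)) expr2 mulfK// gt_eqF// sqrtr_gt0.
have rd' : r = d / eps.
  rewrite /r /d sqrtrM ?(ltW eta0)// sqrtrM ?(ltW eta0)// sqrtrV ?(ltW eps0)//.
  rewrite -mulrA; congr (_ * _).
  rewrite -{3}(sqr_sqrtr (ltW eps0)) expr2 invfM mulrA divff ?mul1r//.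
  by rewrite gt_eqF// sqrtr_gt0.
have -> : 2^-1 * (eta eps * cw' * (n%:R * (n%:R * (C / d) ^+ 2)) * (C * d))
     + kappa / eps * (C * d) = K * r.
  rewrite /K mulrDl {1}rd rd'; field.
  by rewrite !gt_eqF.
rewrite -!EFinD lee_fin.
by move: tau0 Cd Kr; lra.
Unshelve. all: by end_near. Qed.

Lemma recovery_sequence u chi : L1_vector Omega u -> L1_scalar Omega chi ->
  {ae mu, forall x, Omega x -> chi x = 0} ->
  exists ueps chieps, L1_converging Omega ueps chieps u chi /\
    forall tau, 0 < tau -> \forall eps \near 0^'+,
      (E eps (ueps eps) (chieps eps) <= tau%:E)%E.
Proof.
move=> iu ichi chi0.
pose good := [set p : ('rV[R]_n -> 'rV[R]_n) * ('rV[R]_n -> R) |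
  L1_vector Omega p.1 /\ L1_scalar Omega p.2].
have i1_0 p : (0 <= \int[mu]_(x in Omega) (`|(p : 'rV[R]_n -> 'rV[R]_n) x - u x|)%:E)%E.
  by apply: integral_ge0 => x _; rewrite lee_fin.
have i2_0 p : (0 <= \int[mu]_(x in Omega) (`|(p : 'rV[R]_n -> R) x - chi x|)%:E)%E.
  by apply: integral_ge0 => x _; rewrite lee_fin.
have E0 eps p q : 0 < eps -> (0 <= E eps p q)%E.
  by move=> eps0; apply: energy_ge0 => //; exact: eta_gt0.
have [||tau tau0|f gf cf] := @near_optimal_choice R _ good (recovery_cost u chi).
- by exists (u, chi).
- by move=> e t e0 _; apply: adde_ge0; [exact: adde_ge0|exact: E0].
- exact: recovery_cost_small.
(* The terms of the cost are nonnegative, so each L^1 distance lies between 0 and a cost that tends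
   to 0. *)
have cvg0 (h : R -> \bar R) : (forall eps, 0 < eps -> (0 <= h eps <= recovery_cost u chi eps (f eps))%E) ->
    h @ 0^'+ --> 0%E.
  move=> hle.
  have fin : \forall eps \near 0^'+, h eps \is a fin_num.
    near=> eps; have eps0 : 0 < eps by near: eps; exact: nbhs_right_gt.
    have /andP[h0 h1] := hle _ eps0; rewrite ge0_fin_numE//.
    apply: (le_lt_trans h1); apply: (@le_lt_trans _ _ 1%:E); last exact: ltry.
    by near: eps; exact: cf.
  apply/fine_cvgP; split => //; apply/cvgrPdist_le => tau tau0.
  near=> eps; have eps0 : 0 < eps by near: eps; exact: nbhs_right_gt.
  have /andP[h0 h1] := hle _ eps0.
  rewrite sub0r normrN ger0_norm ?fine_ge0// -lee_fin fineK; last by near: eps.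
  by apply: (le_trans h1); near: eps; exact: cf.
exists (fun eps => (f eps).1), (fun eps => (f eps).2); split; last first.
  move=> tau tau0; near=> eps; have eps0 : 0 < eps by near: eps; exact: nbhs_right_gt.
  apply: (@le_trans _ _ (recovery_cost u chi eps (f eps))).
    by apply: leeDr; exact: adde_ge0.
  by near: eps; exact: cf.
split; first by move=> eps _; exact: gf.
- apply: cvg0 => eps eps0; rewrite i1_0 /recovery_cost -addeA.
  by apply: leeDl; apply: adde_ge0 => //; exact: E0.
- apply: cvg0 => eps eps0; rewrite i2_0 /recovery_cost addeAC addeC.
  by apply: leeDl; apply: adde_ge0 => //; exact: E0.
Unshelve. all: by end_near. Qed.

Lemma gamma_limit : Gamma_converges Omega E (limit_functional Omega).
Proof.
move=> u chi iu ichi; rewrite /limit_functional /Gamma_liminf /Gamma_limsup.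
have Enear ueps chieps : \forall eps \near 0^'+, (0 <= E eps (ueps eps) (chieps eps))%E.
  near=> eps; have eps0 : 0 < eps by near: eps; exact: nbhs_right_gt.
  by apply: energy_ge0 => //; exact: eta_gt0.
case: asboolP => chi0.
- have [ueps [chieps [cv small]]] := recovery_sequence iu ichi chi0.
  split; apply/eqP; rewrite eq_le; apply/andP; split.
  + apply: ge_ereal_inf; eexists; first by exists ueps, chieps; split; [exact: cv|].
    by apply/lee_addgt0Pr => tau tau0; rewrite add0e; apply: limf_einf_le; exact: small.
  + by apply/ereal_infP => _ [v [psi [_ ->]]]; exact: limf_einf_ge.
  + apply: ge_ereal_inf; eexists; first by exists ueps, chieps; split; [exact: cv|].
    by apply/lee_addgt0Pr => tau tau0; rewrite add0e; apply: limf_esup_le; exact: small.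
  + by apply/ereal_infP => _ [v [psi [_ ->]]]; exact: limf_esup_ge.
(* When [chi] is not 0, a lower or upper limit below some real [M] would contradict
   [limit_phase_eq0], so every competing family has limit +oo. *)
- have lty (x : \bar R) : (forall M : R, ~ (x < M%:E)%E) -> x = +oo%E.
    case: x => [s| |] H //; exfalso; last by apply: (H 0); exact: ltNyr.
    by apply: (H (s + 1)); rewrite lte_fin ltrDl.
  split; apply/ereal_inf_pinfty => _ [v [psi [cv ->]]]; apply: lty => M ltM;
    apply: chi0; apply: (limit_phase_eq0 (M := M) ichi cv).
    exact: (limf_einf_lt_frequently ltM).
  exact: (limf_esup_lt_frequently ltM).
Unshelve. all: by end_near. Qed.

End gamma_limit.

Theorem theorem4p1 (R : realType) (n : nat) (hn : (0 < n)%N)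
    (Omega : set 'rV[R]_n) (hopen : open Omega) (hbounded : bounded_set Omega)
    (Aw As : {linear 'M[R]_n -> 'M[R]_n})
    (hAw : elasticity_tensor Aw) (hAs : elasticity_tensor As)
    (cw cs cw' cs' : R) (hcw : 0 < cw) (hcs : 0 < cs)
    (hcw' : 0 < cw') (hcs' : 0 < cs')
    (hboundw : forall xi : 'M[R]_n, symmetric_mx xi ->
       cw * frobenius_norm xi ^+ 2 <= frobenius (Aw xi) xi
         <= cw' * frobenius_norm xi ^+ 2)
    (hbounds : forall xi : 'M[R]_n, symmetric_mx xi ->
       cs * frobenius_norm xi ^+ 2 <= frobenius (As xi) xi
         <= cs' * frobenius_norm xi ^+ 2)
    (kappa : R) (hkappa : 0 < kappa)
    (eta : R -> R) (heta_pos : forall eps, 0 < eps -> 0 < eta eps)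
    (heta : eta eps @[eps --> 0^'+] --> 0)
    (halpha : eta eps / eps @[eps --> 0^'+] --> 0) :
  Gamma_converges Omega (energy Omega Aw As kappa eta)
    (limit_functional Omega).
Proof.
apply: (@gamma_limit _ _ _ hopen hbounded _ _ cw') => //.
- exact: ltW.
- move=> xi sxi; have /andP[+ _] := hboundw xi sxi; apply: le_trans.
  by rewrite mulr_ge0 ?sqr_ge0// ltW.
- move=> xi sxi; have /andP[+ _] := hbounds xi sxi; apply: le_trans.
  by rewrite mulr_ge0 ?sqr_ge0// ltW.
- by move=> xi sxi; have /andP[_] := hboundw xi sxi; rewrite frobenius_normK.
Qed.
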